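(* Let $\Gamma$ be the multi-linear operator of the context, let $d\ge1$, and let $0<p\le1$, $p<p_0$. Let $F_p$ and $\Phi_p$ be the probability distributions on $\mathbb{R}^d$ and on $[0,\infty)$ defined in the context, and for $s>0$ put $$m_{2s}(F_p)=\int_{\mathbb{R}^d}dv\,F_p(|v|)|v|^{2s},\qquad m_s(\Phi_p)=\int_0^\infty dv\,\Phi_p(v)v^s.$$ [i] If $0<p<1$, then $m_{2s}(F_p)$ and $m_s(\Phi_p)$ are finite if and only if $0<s<p$. [ii] If $p=1$, then each of the following holds both for $m_s=m_{2s}(F_1)$ and for $m_s=m_s(\Phi_1)$: - if the equation $\mu(s)=\mu(1)$ has the only solution $s=1$, then $m_s<\infty$ for any $s>0$; - if this equation has two solutions $s=1$ and $s=s_*>1$, then $m_s<\infty$ for $s<s_*$ and $m_s=\infty$ for $s>s_*$; and $m_{s_*}<\infty$ only if $I_n(s_* )=0$ for all $n=2,\dots,N$, where $$I_n(s)=\int_{\mathbb{R}_+^n}da_1\cdots da_n\,A_n(a_1,\dots,a_n)\int_{\mathbb{R}_+^n}d\tau_1\cdots d\tau_n\Big[\Big(\sum_{k=1}^na_k\tau_k\Big)^s-\sum_{k=1}^n(a_k\tau_k)^s\Big]\prod_{j=1}^nR_1(\tau_j).$$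
   Context: $\mathbb{R}_+=[0,\infty)$. Let $N\ge2$, $\alpha_n\ge0$, $\sum_{n=1}^N\alpha_n=1$, $\alpha_N>0$. For each $n$, $A_n(a_1,\dots,a_n)\ge0$ is a generalized density of a (Borel) probability measure on $(0,\infty)^n$, supported in a bounded set, symmetric under permutations of its arguments. For bounded continuous $u$ on $\mathbb{R}_+$ define $$\Gamma(u)(x)=\sum_{n=1}^N\alpha_n\int_0^\infty da_1\cdots\int_0^\infty da_n\,A_n(a_1,\dots,a_n)\prod_{k=1}^nu(a_kx),$$ $$K(a)=\sum_{n=1}^Nn\alpha_n\int_0^\infty da_2\cdots\int_0^\infty da_n\,A_n(a,a_2,\dots,a_n),\qquad\lambda(p)=\int_0^\infty da\,K(a)a^p,\qquad\mu(p)=\frac{\lambda(p)-1}{p}\quad(p>0).$$ $p_0\in(0,\infty]$ denotes the unique point at which $\mu$ attains its minimum on $(0,\infty)$, with $p_0=\infty$ if $\mu$ is decreasing on all of $(0,\infty)$. For $\mu\in\mathbb{R}$, $\Gamma_\mu(u)(x)=\int_0^1d\tau\,\Gamma(u)(x\tau^\mu)$. For $0<p<p_0$, $\psi_p$ is the self-similar profile: the pointwise limit of the iterates $\psi^{(n+1)}=\Gamma_{\mu(p)}(\psi^{(n)})$, $\psi^{(0)}(x)=e^{-x^p}$. It has a representation $$\psi_p(x)=\int_0^\infty d\tau\,R_p(\tau)e^{-\tau x^p},\qquad\int_0^\infty d\tau\,R_p(\tau)=\int_0^\infty d\tau\,R_p(\tau)\tau=1,$$ with a unique probability measure $R_p(\tau)d\tau$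 on $[0,\infty)$. For $0<p\le1$, $p<p_0$: $F_p$ is the isotropic probability distribution on $\mathbb{R}^d$ with $\int_{\mathbb{R}^d}dv\,F_p(|v|)e^{-ik\cdot v}=\psi_p(|k|^2)$, $k\in\mathbb{R}^d$, and $\Phi_p$ is the probability distribution on $[0,\infty)$ with $\int_0^\infty dv\,\Phi_p(v)e^{-xv}=\psi_p(x)$, $x\ge0$. (Densities are understood in the generalized sense, as measures.) *)

(* Defs.v *)
From HB Require Import structures.
From mathcomp Require Import all_boot all_order perm all_algebra.
From mathcomp Require Import all_classical all_reals all_analysis.
Set Implicit Arguments.
Unset Strict Implicit.
Unset Printing Implicit Defensive.
Import Order.TTheory GRing.Theory Num.Theory.
Import numFieldNormedType.Exports.
Local Open Scope classical_set_scope.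
Local Open Scope ring_scope.

(* R^n is n.-tuple R with the product sigma-algebra, i.e. the Borel sets. *)
Notation Rn R n := (n.-tuple (measurableTypeR R)).

Section first_coordinate.
Context d (T : measurableType d) (n : nat).

Definition tfirst (a : n.+1.-tuple T) : T := tnth a ord0.

Let measurable_tfirst : measurable_fun [set: n.+1.-tuple T] tfirst.
Proof. exact: measurable_tnth. Qed.

HB.instance Definition _ := isMeasurableFun.Build _ _ _ _ tfirst
  measurable_tfirst.

Definition tcons (x : T * n.-tuple T) : n.+1.-tuple T := [tuple of x.1 :: x.2].

Let measurable_tcons : measurable_fun [set: T * n.-tuple T] tcons.
Proof. exact: measurable_cons. Qed.

HB.instance Definition _ := isMeasurableFun.Build _ _ _ _ tcons
  measurable_tcons.

End first_coordinate.

Section product_probability.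
Context d1 d2 (T1 : measurableType d1) (T2 : measurableType d2) (R : realType).
Variables (P : probability T1 R) (Q : probability T2 R).

Let product_setT : (P \x Q)%E [set: T1 * T2] = 1%E.
Proof.
rewrite -setXTT product_measure1E//.
by rewrite -[RHS]mule1; congr (_ * _)%E; exact: probability_setT.
Qed.

Definition prod_prob : probability (T1 * T2)%type R :=
  HB.pack (P \x Q)%E (Measure_isProbability.Build _ _ _ (P \x Q)%E product_setT).

End product_probability.

Fixpoint power_prob d (T : measurableType d) (R : realType)
    (P : probability T R) (n : nat) : probability (n.-tuple T) R :=
  match n with
  | 0 => \d_([tuple] : 0.-tuple T)
  | n'.+1 => distribution (prod_prob P (power_prob P n')) (@tcons _ T n')
  end.

Section measures_on_Rn.
Context (R : realType) (n : nat).

Definition orthant : set (Rn R n) := [set a | forall i, 0 <= tnth a i].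

Definition bounded_positive_support (A : probability (Rn R n) R) : Prop :=
  exists C : R, A [set a | forall i, 0 < tnth a i <= C] = 1%E.

Definition symmetric_measure (A : probability (Rn R n) R) : Prop :=
  forall (s : 'S_n) (B : set (Rn R n)), measurable B ->
    A [set a | B [tuple tnth a (s i) | i < n]] = A B.

Definition dotp (k v : Rn R n) : R := \sum_(i < n) tnth k i * tnth v i.

Definition enorm (v : Rn R n) : R := Num.sqrt (dotp v v).

Definition isotropic (F : probability (Rn R n) R) : Prop :=
  forall Q : 'M[R]_n, Q *m Q^T = 1%:M ->
  forall B : set (Rn R n), measurable B ->
    F [set v | B [tuple \sum_(j < n) Q i j * tnth v j | i < n]] = F B.

(* [\int F(dv) exp(- i k.v) = g k] for a real-valued g, split into the real and
   imaginary parts of exp(- i k.v). *)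
Definition has_fourier_transform (F : probability (Rn R n) R)
    (g : Rn R n -> R) : Prop :=
  forall k, \int[F]_v cos (dotp k v) = g k /\ \int[F]_v - sin (dotp k v) = 0.

Definition moment2 (F : probability (Rn R n) R) (s : R) : \bar R :=
  (\int[F]_v ((enorm v) `^ (2 * s))%:E)%E.

End measures_on_Rn.

Section measures_on_halfline.
Context (R : realType).

Definition on_halfline (P : probability (measurableTypeR R) R) : Prop :=
  P `[0, +oo[%classic = 1%E.

Definition laplace (P : probability (measurableTypeR R) R) (x : R) : R :=
  \int[P]_(v in `[0, +oo[) expR (- (x * v)).

Definition moment (P : probability (measurableTypeR R) R) (s : R) : \bar R :=
  (\int[P]_(v in `[0%R, +oo[) (v `^ s)%:E)%E.

End measures_on_halfline.

Section maxwell_model.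
Context (R : realType) (N : nat).
Variables (alpha : nat -> {nonneg R}) (A : forall n, probability (Rn R n) R).

(* Sums over n = 1, ..., N are written with n.+1 for n < N; alpha 0 and A 0
   are never used. *)

Definition Gamma (u : R -> R) (x : R) : R :=
  \sum_(n < N) (alpha n.+1)%:num *
    \int[A n.+1]_(a in @orthant R n.+1) \prod_(k < n.+1) u (tnth a k * x).

(* The marginal in a_1 of A_n is the image of A_n under a |-> a_1. *)
Definition Kmeasure : {measure set (measurableTypeR R) -> \bar R} :=
  msum (fun n => mscale (n.+1%:R * (alpha n.+1)%:num)%:nng
                   (distribution (A n.+1) (@tfirst _ (measurableTypeR R) n))) N.

Definition lambda (p : R) : R := \int[Kmeasure]_(a in `[0, +oo[) a `^ p.

Definition mu (p : R) : R := (lambda p - 1) / p.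

Definition Gamma_ (m : R) (u : R -> R) (x : R) : R :=
  \int[@lebesgue_measure R]_(t in `[0, 1]) Gamma u (x * t `^ m).

Definition profile_iterate (p : R) (n : nat) : R -> R :=
  iter n (Gamma_ (mu p)) (fun x => expR (- (x `^ p))).

Definition self_similar_profile (p : R) (psi : R -> R) : Prop :=
  forall x, 0 <= x -> profile_iterate p n x @[n --> \oo] --> psi x.

(* The integrand is nonnegative for s >= 1; the integral may be +oo. *)
Definition I_ (R1 : probability (measurableTypeR R) R) (n : nat) (s : R) :
    \bar R :=
  (\int[A n]_(a in @orthant R n) \int[power_prob R1 n]_(t in @orthant R n)
     ((\sum_(k < n) tnth a k * tnth t k) `^ s -
      \sum_(k < n) (tnth a k * tnth t k) `^ s)%R%:E)%E.

End maxwell_model.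

Definition is_minimum_point (R : realType) (f : R -> R) (p0 : \bar R) : Prop :=
  match p0 with
  | EFin r => 0 < r /\ (forall q, 0 < q -> q != r -> f r < f q)
  | EPInf => forall q q', 0 < q -> q < q' -> f q' < f q
  | ENInf => False
  end.

(* P is the measure R_p in [psi x = \int R_p(dt) exp(- t x^p)]. *)
Definition represents (R : realType) (p : R) (psi : R -> R)
    (P : probability (measurableTypeR R) R) : Prop :=
  [/\ on_halfline P, (\int[P]_(t in `[0%R, +oo[) t%:E = 1)%E
    & forall x, 0 <= x -> psi x = laplace P (x `^ p)].

(* Main.v *)
Require Import Defs.
From HB Require Import structures.
From mathcomp Require Import all_boot all_order perm all_algebra.
From mathcomp Require Import all_classical all_reals all_analysis
  measurable_realfun.
From mathcomp Require Import ring lra.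

(* Everything is read off Laplace transforms, which determine the law of a
   nonnegative variable since [E (1 - exp(- j X))^(k_j)] tends to [P (X > t)]
   for suitable [k_j]; expanding the power, bounds on [E (1 - exp(- y X))^k] of
   order [y^s] are bounds on the tail of [X].
   If [p < 1], then [1 - psi x ~ x^p], which decides the moments of [Phi].
   If [p = 1], then [Phi] is the law [R_1], a fixed point of the map sending the
   law of [X] to that of [U^mu (a_1 X_1 + ... + a_n X_n)], [U] uniform, and the
   limit of its iterates started at the Dirac mass at 1. In a moment of order
   [s] of the sum the diagonal terms contribute [lambda s] times the old moment
   and the cross terms only involve lower moments, so the moments of order [s]
   stay bounded along the iteration when [mu s < mu 1], which by convexity of
   [lambda] holds on all of ]1, s_*[. At [s_*] the diagonal terms alone already
   reproduce the moment, and the cross terms are strictly positive: the moment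
   of order [s_*] is infinite, and the assertion on [I_n] is void.
   The moments of [F] reduce to those of [Phi]: with [K] exponentially
   distributed, [K V_j^2] and [K^2 W] have the same law, [W] of law [Phi]. *)

Set Implicit Arguments.
Unset Strict Implicit.
Unset Printing Implicit Defensive.
Import Order.TTheory GRing.Theory Num.Theory.
Import numFieldNormedType.Exports.
Local Open Scope classical_set_scope.
Local Open Scope ring_scope.

(** The fixed-point equation alone cannot show that a moment is finite, since both of its sides may
    be infinite. Finiteness is therefore proved along the iterates, which start from a law with all
    moments equal to 1, by bounds uniform in the number of steps. These bounds must survive a limit
    known only as pointwise convergence of Laplace transforms: [ldiff], a finite difference of the
    transform, passes to the limit, and turning it back into a moment loses an arbitrarily small
    part of the exponent, which is harmless on an interval open to the right. The threshold comes
    from $E\,U^{\mu(1)s}=1/(1+\mu(1)s)$: up to cross terms, one step multiplies the moment of order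
    $s$ by $\lambda(s)/(1+\mu(1)s)$. For $s>0$ this is below 1 exactly when $\mu(s)<\mu(1)$; it
    equals 1 at $s=1$, so the mean is preserved, and again at the second solution. The cross terms
    have orders $s-1$ and 1, so the bounds are found by induction on ranges of $s$ of length one.
    For $p<1$ the order $p$ itself is excluded because a finite moment of order $p$ would force
    $1-\psi(x)=o(x^p)$. *)

(** * Bounded integrands under probability measures, and Fubini for them *)

Section bounded_functions.
Context d (T : measurableType d) (R : realType) (P : probability T R).

Lemma integrable_bounded (f : T -> R) (C : R) :
  measurable_fun setT f -> (forall w, `|f w| <= C) ->
  P.-integrable setT (EFin \o f).
Proof.
move=> mf fC; apply: measurable_bounded_integrable => //.
  by rewrite (le_lt_trans (probability_le1 _ _)) ?ltry.
exists C; split; first by rewrite num_real.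
by move=> x Cx w _ /=; exact: (le_trans (fC w) (ltW Cx)).
Qed.

Lemma EFin_Rintegral (f : T -> R) (C : R) :
  measurable_fun setT f -> (forall w, `|f w| <= C) ->
  (\int[P]_w f w)%:E = (\int[P]_w (f w)%:E)%E.
Proof.
move=> mf fC; rewrite fineK//.
by apply: integrable_fin_num => //; exact: integrable_bounded mf fC.
Qed.

Lemma cvg_Rintegral_bounded (f_ : nat -> T -> R) (f : T -> R) (C : R) :
  (forall n, measurable_fun setT (f_ n)) ->
  (forall n w, `|f_ n w| <= C) -> (forall w, f_ n w @[n --> \oo] --> f w) ->
  \int[P]_w f_ n w @[n --> \oo] --> \int[P]_w f w.
Proof.
move=> mf_ fC f_f.
have mf : measurable_fun setT f by apply: (measurable_fun_cvg mf_) => w _.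
have fleC w : `|f w| <= C.
  have nf : `|f_ n w| @[n --> \oo] --> `|f w| by exact: cvg_norm (f_f w).
  rewrite -(cvg_lim (@Rhausdorff R) nf).
  by apply: limr_le; [exact: cvgP nf|exact: nearW].
have /fine_cvgP[_] : (\int[P]_w (f_ n w)%:E)%E @[n --> \oo] -->
    (\int[P]_w f w)%:E.
  rewrite (EFin_Rintegral mf fleC).
  apply: (@dominated_cvg _ _ _ P setT _ (fun n w => (f_ n w)%:E) _ (cst C%:E)).
  - exact: measurableT.
  - by move=> n; exact/measurable_EFinP/mf_.
  - by move=> w _; apply: cvg_EFin; [exact: nearW|exact: f_f].
  - by [].
  - apply: (@integrable_bounded (cst C) `|C|); first exact: measurable_cst.
    by move=> w.
  - by move=> n w _; rewrite lee_fin fC.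
by [].
Qed.

(** It lets the restrictions to the half-line, the orthant or a bounded box be traded for absolute
    values: outside a set of full measure the integrand may be replaced by any measurable one. *)
Lemma prob_eq_integral (D : set T) (f g : T -> \bar R) : measurable D ->
  P D = 1%E -> measurable_fun D f -> measurable_fun setT g ->
  {in D, f =1 g} -> (\int[P]_(w in D) f w = \int[P]_w g w)%E.
Proof.
move=> mD PD mf mg fg; rewrite integral_mkcond; apply: ae_eq_integral => //.
  by apply/(measurable_restrictT _ mD).
exists (~` D); split; first exact: measurableC.
  by apply: etrans (probability_setC P mD) _; rewrite PD subee.
apply: subsetC => w Dw _ /=; rewrite patchE mem_set//; exact/fg/mem_set.
Qed.

Lemma prob_eq_Rintegral (D : set T) (f g : T -> R) : measurable D ->
  P D = 1%E -> measurable_fun D f -> measurable_fun setT g ->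
  {in D, f =1 g} -> \int[P]_(w in D) f w = \int[P]_w g w.
Proof.
move=> mD PD mf mg fg; rewrite /Rintegral; congr fine.
apply: prob_eq_integral => //; try exact/measurable_EFinP.
by move=> w /fg /= ->.
Qed.

Lemma Rintegral_itv01 (f : T -> R) :
  measurable_fun setT f -> (forall w, 0 <= f w <= 1) ->
  0 <= \int[P]_w f w <= 1.
Proof.
move=> mf f01; have f0 w : 0 <= f w by have /andP[] := f01 w.
have f1 w : `|f w| <= 1 by rewrite ger0_norm//; have /andP[] := f01 w.
rewrite Rintegral_ge0//=.
have -> : 1 = \int[P]_w (cst 1 w) :> R.
  by rewrite Rintegral_cst// [X in fine X](@probability_setT _ _ _ P) mulr1.
apply: le_Rintegral => //.
- exact: integrable_bounded f1.
- by apply: (@integrable_bounded _ 1) => // w; rewrite normr1.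
- by move=> w _; rewrite (le_trans (ler_norm _)).
Qed.

End bounded_functions.

Section bounded_fubini.
Context d1 d2 (T1 : measurableType d1) (T2 : measurableType d2) (R : realType).
Variables (P : probability T1 R) (Q : probability T2 R).

Lemma ge0_integral_prod_prob (f : T1 * T2 -> \bar R) :
  measurable_fun setT f -> (forall w, (0 <= f w)%E) ->
  (\int[prod_prob P Q]_w f w = \int[P]_x \int[Q]_y f (x, y))%E.
Proof. by move=> mf f0; rewrite [LHS](@fubini_tonelli1 _ _ _ _ _ P Q). Qed.

Variables (f : T1 * T2 -> R) (C : R).
Hypotheses (mf : measurable_fun setT f) (fC : forall w, `|f w| <= C).

Let EQ x : (\int[Q]_y f (x, y))%:E = (\int[Q]_y (f (x, y))%:E)%E.
Proof.
apply: (@EFin_Rintegral _ _ _ _ _ C) => //.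
exact: measurableT_comp mf (measurable_pair1 x).
Qed.

Let EP y : (\int[P]_x f (x, y))%:E = (\int[P]_x (f (x, y))%:E)%E.
Proof.
apply: (@EFin_Rintegral _ _ _ _ _ C) => //.
exact: measurableT_comp mf (measurable_pair2 y).
Qed.

Let intf : (P \x Q)%E.-integrable setT (EFin \o f).
Proof. exact: (@integrable_bounded _ _ _ (prod_prob P Q) _ C). Qed.

Lemma Rintegral_prod_prob :
  \int[prod_prob P Q]_w f w = \int[P]_x \int[Q]_y f (x, y).
Proof.
rewrite /Rintegral; congr fine.
rewrite [LHS](_ : _ = \int[P]_x \int[Q]_y (f (x, y))%:E)%E.
  by apply: eq_integral => x _; rewrite EQ.
by rewrite (@integral12_prod_meas1 _ _ _ _ _ P Q (EFin \o f) intf).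
Qed.

Lemma Rintegral_prod_prob2 :
  \int[prod_prob P Q]_w f w = \int[Q]_y \int[P]_x f (x, y).
Proof.
rewrite /Rintegral; congr fine.
rewrite [LHS](_ : _ = \int[Q]_y \int[P]_x (f (x, y))%:E)%E.
  by apply: eq_integral => y _; rewrite EP.
by rewrite (@integral21_prod_meas1 _ _ _ _ _ P Q (EFin \o f) intf).
Qed.

Lemma measurable_Rintegral1 :
  measurable_fun setT (fun x => \int[Q]_y f (x, y)).
Proof.
apply/measurable_EFinP.
apply: (eq_measurable_fun (fun x => (\int[Q]_y (f (x, y))%:E)%E)).
  by move=> x _ /=; rewrite EQ.
exact: (@measurable_fubini_F _ _ _ _ _ P Q _ intf).
Qed.

End bounded_fubini.

(** * Laplace transforms of nonnegative variables and their finite differences *)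

Section laplace_difference.
Context (R : realType).

(** A function on an arbitrary probability space, rather than a law, because some of the transforms
    compared later belong to variables such as $|\ln u|\,v_j^2$ on product spaces. *)
Definition laplace_rv d (T : measurableType d) (P : probability T R)
    (X : T -> R) (x : R) : R :=
  \int[P]_w expR (- (x * X w)).

(** Up to the sign $(-1)^k$ this is the [k]-th finite difference with step [y] of the transform at
    [z], hence a combination of its values at $z, z+y,\dots,z+ky$: equalities and pointwise limits
    of transforms carry over to it. The factor with [z] makes the recursion [ldiffS] close. *)
Definition ldiff d (T : measurableType d) (P : probability T R) (X : T -> R)
    (k : nat) (y z : R) : R :=
  \int[P]_w (expR (- (z * X w)) * (1 - expR (- (y * X w))) ^+ k).

Section one_space.
Context d (T : measurableType d) (P : probability T R) (X : T -> R).
Hypotheses (mX : measurable_fun setT X) (X0 : forall w, 0 <= X w).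

Lemma measurable_expRN (x : R) :
  measurable_fun setT (fun w => expR (- (x * X w))).
Proof.
apply: measurableT_comp => //; apply: measurableT_comp => //.
by apply: measurable_funM => //; exact: measurable_cst.
Qed.

Lemma expRN_itv01 (x : R) w : 0 <= x -> 0 <= expR (- (x * X w)) <= 1.
Proof. by move=> x0; rewrite expR_ge0/= -expR0 ler_expR oppr_le0 mulr_ge0. Qed.

Lemma laplace_rv_itv01 x : 0 <= x -> 0 <= laplace_rv P X x <= 1.
Proof.
move=> x0; apply: Rintegral_itv01; first exact: measurable_expRN.
by move=> w; exact: expRN_itv01.
Qed.

Let f k y z w := expR (- (z * X w)) * (1 - expR (- (y * X w))) ^+ k.

Lemma measurable_ldiff_fun k y z : measurable_fun setT (f k y z).
Proof.
apply: measurable_funM; first exact: measurable_expRN.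
apply: measurable_funX; apply: measurable_funB; first exact: measurable_cst.
exact: measurable_expRN.
Qed.

Lemma ldiff_fun_itv01 k y z w : 0 <= y -> 0 <= z -> 0 <= f k y z w <= 1.
Proof.
move=> y0 z0; have /andP[a0 a1] := expRN_itv01 w y0.
have /andP[b0 b1] := expRN_itv01 w z0.
rewrite mulr_ge0 ?exprn_ge0 ?subr_ge0//= mulr_ile1 ?exprn_ge0 ?subr_ge0//.
by rewrite exprn_ile1 ?subr_ge0// lerBlDr lerDl.
Qed.

Lemma ldiff_fun_norm k y z w : 0 <= y -> 0 <= z -> `|f k y z w| <= 1.
Proof.
by move=> y0 z0; have /andP[? ?] := ldiff_fun_itv01 k w y0 z0; rewrite
  ger0_norm.
Qed.

Lemma integrable_ldiff k y z : 0 <= y -> 0 <= z ->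
  P.-integrable setT (EFin \o f k y z).
Proof.
move=> y0 z0; apply: (@integrable_bounded _ _ _ P _ 1).
  exact: measurable_ldiff_fun.
by move=> w; exact: ldiff_fun_norm.
Qed.

Lemma ldiff0 y z : ldiff P X 0 y z = laplace_rv P X z.
Proof. by apply: eq_Rintegral => w _; rewrite expr0 mulr1. Qed.

Lemma ldiffS k y z : 0 <= y -> 0 <= z ->
  ldiff P X k.+1 y z = ldiff P X k y z - ldiff P X k y (z + y).
Proof.
move=> y0 z0; rewrite /ldiff -RintegralB//=.
- apply: eq_Rintegral => w _.
  by rewrite mulrDl opprD expRD exprS; ring.
- exact: integrable_ldiff.
- by apply: integrable_ldiff => //; rewrite addr_ge0.
Qed.

End one_space.

Lemma cvg_ldiff d1 d2 (T1 : measurableType d1) (T2 : measurableType d2)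
    (P_ : nat -> probability T1 R) (Q : probability T2 R)
    (X : T1 -> R) (Y : T2 -> R) :
  measurable_fun setT X -> (forall w, 0 <= X w) ->
  measurable_fun setT Y -> (forall w, 0 <= Y w) ->
  (forall x, 0 <= x ->
    laplace_rv (P_ n) X x @[n --> \oo] --> laplace_rv Q Y x) ->
  forall k y z, 0 <= y -> 0 <= z ->
    ldiff (P_ n) X k y z @[n --> \oo] --> ldiff Q Y k y z.
Proof.
move=> mX X0 mY Y0 PQ; elim=> [|k IHk] y z y0 z0.
  by rewrite ldiff0; under eq_cvg do rewrite ldiff0; exact: PQ.
rewrite ldiffS//; under eq_cvg do rewrite ldiffS//.
by apply: cvgB; apply: IHk => //; rewrite addr_ge0.
Qed.

Lemma eq_ldiff d1 d2 (T1 : measurableType d1) (T2 : measurableType d2)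
    (P : probability T1 R) (Q : probability T2 R)
    (X : T1 -> R) (Y : T2 -> R) :
  measurable_fun setT X -> (forall w, 0 <= X w) ->
  measurable_fun setT Y -> (forall w, 0 <= Y w) ->
  (forall x, 0 <= x -> laplace_rv P X x = laplace_rv Q Y x) ->
  forall k y z, 0 <= y -> 0 <= z -> ldiff P X k y z = ldiff Q Y k y z.
Proof.
move=> mX X0 mY Y0 PQ; elim=> [|k IHk] y z y0 z0.
  by rewrite !ldiff0 PQ.
by rewrite !ldiffS// !IHk// addr_ge0.
Qed.

End laplace_difference.

(** * Uniqueness: the transform determines the tails and the moments *)

Lemma bernoulli_onem (R : realDomainType) (q : R) (k : nat) :
  0 <= q <= 1 -> 1 - k%:R * q <= (1 - q) ^+ k.
Proof.
move=> /andP[q0 q1]; elim: k => [|k IHk]; first by rewrite mul0r subr0 expr0.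
rewrite exprS; apply: le_trans (ler_wpM2l _ IHk); last by rewrite subr_ge0.
rewrite -natr1; have : 0 <= k%:R * q * q by rewrite !mulr_ge0.
by lra.
Qed.

(* The exponents [k_j] are of order [j e^(j t)], so that [k_j e^(- j v)] tends
   to 0 for [v > t] and to infinity for [v <= t]. *)
Section laplace_uniqueness.
Context (R : realType).

Let k_ (t : R) (n : nat) : nat :=
  (Num.Def.trunc (n.+1%:R * expR (n.+1%:R * t))).+1.

Lemma cvg_onem_expR_indic (t v : R) : 0 <= t -> 0 <= v ->
  (1 - expR (- (n.+1%:R * v))) ^+ k_ t n @[n --> \oo] --> ((t < v)%R%:R : R).
Proof.
move=> t0 v0.
have q01 n : 0 <= expR (- (n.+1%:R * v)) <= 1.
  by rewrite expR_ge0/= -expR0 ler_expR oppr_le0 mulr_ge0.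
have kx n : n.+1%:R * expR (n.+1%:R * t) <= (k_ t n)%:R by exact/ltW/truncnS_gt.
have xk n : (k_ t n)%:R <= n.+1%:R * expR (n.+1%:R * t) + 1.
  by rewrite /k_ -natr1 lerD2r truncn_le// mulr_ge0// expR_ge0.
(* With $q=e^{-(n+1)v}$ and $v\le t$, the choice of [k_] gives $k_nq\ge n+1$, so $(1-q)^{k_n}\le
   e^{-k_nq}\le e^{-(n+1)}\le 1/(n+1)$. *)
have [vt|tv] := leP v t.
  apply: (@squeeze_cvgr _ _ _ _ (cst 0) harmonic).
  - apply: nearW => n /=; have /andP[q0 q1] := q01 n.
    rewrite exprn_ge0 ?subr_ge0//=.
    have le1 : 1 - expR (- (n.+1%:R * v)) <= expR (- expR (- (n.+1%:R * v))).
      exact: expR_ge1Dx.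
    have le2 : (1 - expR (- (n.+1%:R * v))) ^+ k_ t n <=
        expR (- expR (- (n.+1%:R * v))) ^+ k_ t n.
      by rewrite lerXn2r ?nnegrE ?expR_ge0 ?subr_ge0.
    apply: (le_trans le2); rewrite -expRM_natl mulrN [leLHS]expRN.
    rewrite /harmonic /= lef_pV2 ?posrE ?expR_gt0//.
    apply: (@le_trans _ _ (expR n.+1%:R)).
      by rewrite (le_trans _ (expR_ge1Dx _))// lerDr.
    rewrite ler_expR; apply: (le_trans _ (ler_wpM2r q0 (kx n))).
    rewrite -mulrA -expRD ler_peMr// -expR0 ler_expR.
    by rewrite -mulrBr mulr_ge0// subr_ge0.
  - exact: cvg_cst.
  - exact: cvg_harmonic.
(* With $a=n+1$ and $b=v-t>0$, Bernoulli bounds the distance to 1 by $k_nq\le ae^{-ab}+e^{-av}\le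
   2ae^{-ab}$, and $e^{-x}\le 2/x^2$ turns this into $4/(ab^2)$, which is [c * harmonic n]. *)
pose c := 4 / (v - t) ^+ 2.
apply: (@squeeze_cvgr _ _ _ _ (fun n => 1 - c * harmonic n) (cst 1)).
- apply: nearW => n /=; have /andP[q0 q1] := q01 n.
  apply/andP; split; last by rewrite exprn_ile1 ?subr_ge0// lerBlDr lerDl.
  apply: le_trans (bernoulli_onem _ (q01 n)); rewrite lerD2l lerN2.
  apply: (le_trans (ler_wpM2r q0 (xk n))).
  rewrite mulrDl mul1r -mulrA -expRD -mulrBr -(opprB v t) mulrN.
  have vt0 : 0 < v - t by rewrite subr_gt0.
  set a : R := n.+1%:R; have a1 : 1 <= a by rewrite ler1n.
  have a0 : 0 < a by exact: lt_le_trans a1.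
  have h : expR (- (a * v)) <= a * expR (- (a * (v - t))).
    rewrite -[leLHS]mul1r ler_pM ?expR_ge0// ler_expR lerN2.
    by rewrite ler_pM2l// gerBl.
  have h2 : expR (- (a * (v - t))) <= 2 / (a * (v - t)) ^+ 2.
    have b0 : 0 < a * (v - t) by rewrite mulr_gt0.
    rewrite expRN -[leRHS]invrK lef_pV2 ?posrE ?invr_gt0 ?expR_gt0//; last
      first.
      by rewrite divr_gt0 ?exprn_gt0.
    rewrite invf_div; apply: le_trans (expR_ge1Dxn 1 (ltW b0)).
    by rewrite lerDr.
  apply: (@le_trans _ _ (2 * (a * expR (- (a * (v - t)))))); first by lra.
  apply: (@le_trans _ _ (2 * (a * (2 / (a * (v - t)) ^+ 2)))).
    by rewrite ler_wpM2l// ler_wpM2l// ltW.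
  rewrite le_eqVlt; apply/orP; left; apply/eqP; rewrite /c /harmonic/= -/a.
  by field; rewrite !gt_eqF.
- rewrite -[X in _ --> X]subr0; apply: cvgB; first exact: cvg_cst.
  rewrite -[X in _ --> X](mulr0 c); apply: cvgM; first exact: cvg_cst.
  exact: cvg_harmonic.
- exact: cvg_cst.
Qed.

Lemma cvg_ldiff_tail d (T : measurableType d) (P : probability T R) (X : T -> R)
    (t : R) : measurable_fun setT X -> (forall w, 0 <= X w) -> 0 <= t ->
  ldiff P X (k_ t n) n.+1%:R 0 @[n --> \oo] --> fine (P [set w | t < X w]).
Proof.
move=> mX X0 t0.
have -> : fine (P [set w | t < X w]) = \int[P]_w (\1_[set w | t < X w] w).
  rewrite /Rintegral integral_indic ?setIT//.
  by rewrite -[X in measurable X]setTI; apply: (measurable_fun_ltr _ mX).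
apply: (@cvg_Rintegral_bounded _ _ _ _ _ _ 1).
- by move=> n; exact: measurable_ldiff_fun.
- by move=> n w; exact: ldiff_fun_norm.
- move=> w; under eq_cvg do rewrite mul0r oppr0 expR0 mul1r.
  by rewrite indicE mem_setE; exact: cvg_onem_expR_indic.
Qed.

Lemma laplace_rv_unique d1 d2 (T1 : measurableType d1) (T2 : measurableType d2)
    (P : probability T1 R) (Q : probability T2 R)
    (X : T1 -> R) (Y : T2 -> R) :
  measurable_fun setT X -> (forall w, 0 <= X w) ->
  measurable_fun setT Y -> (forall w, 0 <= Y w) ->
  (forall x, 0 <= x -> laplace_rv P X x = laplace_rv Q Y x) ->
  forall t, 0 <= t -> P [set w | t < X w] = Q [set w | t < Y w].
Proof.
move=> mX X0 mY Y0 PQ t t0.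
rewrite -[LHS]fineK ?fin_num_measure//; last first.
  by rewrite -[X in measurable X]setTI; apply: (measurable_fun_ltr _ mX).
rewrite -[RHS]fineK ?fin_num_measure//; last first.
  by rewrite -[X in measurable X]setTI; apply: (measurable_fun_ltr _ mY).
have cX := cvg_ldiff_tail (P := P) mX X0 t0.
have cY := cvg_ldiff_tail (P := Q) mY Y0 t0.
congr EFin; apply: (cvg_unique (@Rhausdorff R) cX).
suff -> : (fun n => ldiff P X (k_ t n) n.+1%:R 0) =
  (fun n => ldiff Q Y (k_ t n) n.+1%:R 0) by exact: cY.
by apply/funext => n; exact: eq_ldiff.
Qed.

End laplace_uniqueness.

Section moments_rv.
Context (R : realType).

Lemma ge0_integral_tail d (T : measurableType d) (P : probability T R)
    (X : T -> R) : measurable_fun setT X -> (forall w, 0 <= X w) ->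
  (\int[P]_w (X w)%:E =
   \int[lebesgue_measure]_(r in `[0%R, +oo[) P [set w | (r < X w)%R])%E.
Proof.
move=> mX X0; have Xm : X \in mfun by rewrite inE.
rewrite -(expectation_def (mfun_Sub Xm)) ge0_expectation_ccdf//.
apply: eq_integral => r _; rewrite /ccdf /distribution /pushforward.
by congr (P _); apply/seteqP; split => w /=; rewrite in_itv/= andbT.
Qed.

(** The moment is the integral over $r\ge0$ of the probability of $X^s>r$, that is of $X>r^{1/s}$,
    and these tails are determined by the transform. Infinite moments are covered too. *)
Lemma eq_moment_laplace_rv d1 d2 (T1 : measurableType d1)
    (T2 : measurableType d2) (P : probability T1 R) (Q : probability T2 R)
    (X : T1 -> R) (Y : T2 -> R) (s : R) :
  measurable_fun setT X -> (forall w, 0 <= X w) ->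
  measurable_fun setT Y -> (forall w, 0 <= Y w) -> 0 < s ->
  (forall x, 0 <= x -> laplace_rv P X x = laplace_rv Q Y x) ->
  (\int[P]_w (X w `^ s)%:E = \int[Q]_w (Y w `^ s)%:E)%E.
Proof.
move=> mX X0 mY Y0 s0 PQ.
have tail d (T : measurableType d) (P' : probability T R) (Z : T -> R) :
    measurable_fun setT Z -> (forall w, 0 <= Z w) ->
    (\int[P']_w (Z w `^ s)%:E = \int[lebesgue_measure]_(r in `[0%R, +oo[)
      P' [set w | (r `^ s^-1 < Z w)%R])%E.
  move=> mZ Z0; rewrite (@ge0_integral_tail _ _ P' (fun w => Z w `^ s)).
  - apply: eq_integral => r; rewrite inE/= in_itv/= andbT => r0.
    have rE : r = (r `^ s^-1) `^ s by rewrite -powRrM mulVf ?gt_eqF// powRr1.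
    congr (P' _); apply/seteqP; split => w /=; rewrite {1}rE.
      apply: contraTT; rewrite -!leNgt => h.
      by apply: (ge0_ler_powR (ltW s0)); rewrite ?nnegrE ?powR_ge0.
    rewrite -rE => h; rewrite rE.
    have := @gt0_ltr_powR R s s0 (r `^ s^-1) (Z w).
    by rewrite !nnegrE powR_ge0 Z0; apply.
  - exact: (measurableT_comp (measurable_powR s) mZ).
  - by move=> w; exact: powR_ge0.
rewrite (tail _ _ P X mX X0) (tail _ _ Q Y mY Y0).
apply: eq_integral => r _.
exact: (laplace_rv_unique mX X0 mY Y0 PQ (powR_ge0 r s^-1)).
Qed.

End moments_rv.

(** * Integrals over independent copies *)

Section product_formula.
Context d (T : measurableType d) (R : realType) (P : probability T R).

Lemma measurable_tnth_fun n (f : nat -> T -> R) (k : 'I_n) :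
  measurable_fun setT (f k) ->
  measurable_fun setT (fun x : n.-tuple T => f k (tnth x k)).
Proof. by move=> mf; exact: (measurableT_comp mf (measurable_tnth k)). Qed.

(** The factors are indexed by [nat] so that the induction can pass to the shifted family [f k.+1]
    once [tcons] has split off the first coordinate. *)
Lemma integral_power_prob n (f : nat -> T -> R) :
  (forall k, measurable_fun setT (f k)) -> (forall k v, 0 <= f k v) ->
  (\int[power_prob P n]_x (\prod_(k < n) f k (tnth x k))%:E =
   \big[mule/1]_(k < n) \int[P]_v (f k v)%:E)%E.
Proof.
elim: n f => [|n IHn] f mf f0.
  rewrite big_ord0.
  under eq_integral do rewrite big_ord0.
  under eq_integral do rewrite /=.
  by rewrite integral_cst// mul1e; exact: probability_setT.
have mprod m (g : nat -> T -> R) : (forall k, measurable_fun setT (g k)) ->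
    measurable_fun setT (fun x : m.-tuple T => \prod_(k < m) g k (tnth x k)).
  by move=> mg; apply: measurable_prod => k _; exact: measurable_tnth_fun.
rewrite big_ord_recl -(IHn (fun k => f k.+1))//.
rewrite /= ge0_integral_distribution; last 2 first.
- by apply/measurable_EFinP; exact: (mprod n.+1 f).
- by move=> y; rewrite lee_fin prodr_ge0.
have E (w : T * n.-tuple T) : \prod_(k < n.+1) f k (tnth (tcons w) k) =
    f 0 w.1 * \prod_(k < n) f k.+1 (tnth w.2 k).
  rewrite big_ord_recl /tcons tnth0; congr (_ * _).
  by apply: eq_bigr => k _; rewrite tnthS.
rewrite ge0_integral_prod_prob; last 2 first.
- apply: (eq_measurable_fun (fun w : T * n.-tuple T =>
    (f 0 w.1 * \prod_(k < n) f k.+1 (tnth w.2 k))%:E)).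
    by move=> w _ /=; rewrite E.
  apply/measurable_EFinP/measurable_funM.
    exact: (measurableT_comp (mf 0) measurable_fst).
  exact: (measurableT_comp (mprod n (fun k => f k.+1) _) measurable_snd).
- by move=> w /=; rewrite lee_fin prodr_ge0.
under eq_integral => x _.
  under eq_integral => y _ do rewrite /= E EFinM /=.
  rewrite ge0_integralZl//; last 3 first.
  - by apply/measurable_EFinP; apply: (mprod n (fun k => f k.+1)).
  - by move=> y _; rewrite lee_fin prodr_ge0.
  - by rewrite lee_fin.
  over.
rewrite ge0_integralZr//.
- exact/measurable_EFinP/mf.
- by move=> x _; rewrite lee_fin.
- by apply: integral_ge0 => y _; rewrite lee_fin prodr_ge0.
Qed.

Lemma Rintegral_power_prob n (f : nat -> T -> R) :
  (forall k, measurable_fun setT (f k)) -> (forall k v, 0 <= f k v <= 1) ->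
  \int[power_prob P n]_x \prod_(k < n) f k (tnth x k) =
  \prod_(k < n) \int[P]_v f k v.
Proof.
move=> mf f01; have f0 k v : 0 <= f k v by have /andP[] := f01 k v.
have fE k : (\int[P]_v (f k v)%:E)%E = (\int[P]_v f k v)%:E.
  by rewrite (@EFin_Rintegral _ _ _ _ _ 1)// => v; rewrite ger0_norm//;
    have /andP[] := f01 k v.
rewrite [LHS]/Rintegral integral_power_prob//.
rewrite (_ : \big[_/_]_(_ < _) _ = (\prod_(k < n) \int[P]_v f k v)%:E)//.
by elim/big_ind2 : _ => // x a y b -> ->; rewrite EFinM.
Qed.

Lemma integral_power_prob1 n (i : 'I_n) (g : T -> R) :
  measurable_fun setT g -> (forall v, 0 <= g v) ->
  (\int[power_prob P n]_x (g (tnth x i))%:E = \int[P]_v (g v)%:E)%E.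
Proof.
move=> mg g0; pose f k v := if k == i :> nat then g v else 1.
rewrite -[LHS](_ : \int[power_prob P n]_x (\prod_(k < n) f k (tnth x k))%:E =
  _)%E;
  last first.
  apply: eq_integral => x _; rewrite (bigD1 i)//= big1 ?mulr1 /f ?eqxx//.
  by move=> k ki; rewrite ifF//; exact/negbTE.
rewrite integral_power_prob; last 2 first.
- by move=> k; rewrite /f; case: (k == i :> nat) => //; exact: measurable_cst.
- by move=> k v; rewrite /f; case: ifP.
have f1 (k : 'I_n) : k != i -> (\int[P]_v (f k v)%:E = 1)%E.
  move=> ki; have -> : f k = cst 1 by apply/funext => v; rewrite /f ifF//;
    exact/negbTE.
  under eq_integral do rewrite /=.
  by rewrite integral_cst// mul1e; exact: probability_setT.
have fi : f i = g by apply/funext => v; rewrite /f eqxx.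
by rewrite (bigD1 i)//= big1// mule1 fi.
Qed.

Lemma integral_power_prob2 n (i j : 'I_n) (g h : T -> R) : i != j ->
  measurable_fun setT g -> (forall v, 0 <= g v) ->
  measurable_fun setT h -> (forall v, 0 <= h v) ->
  (\int[power_prob P n]_x (g (tnth x i) * h (tnth x j))%:E =
   \int[P]_v (g v)%:E * \int[P]_v (h v)%:E)%E.
Proof.
move=> ij mg g0 mh h0.
pose f k v := if k == i :> nat then g v else if k == j :> nat then h v else 1.
rewrite -[LHS](_ : \int[power_prob P n]_x (\prod_(k < n) f k (tnth x k))%:E =
  _)%E;
  last first.
  apply: eq_integral => x _; rewrite (bigD1 i)//= (bigD1 j) 1?eq_sym//= big1.
    by rewrite mulr1 /f !eqxx ifF//; apply/negbTE; rewrite eq_sym.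
  by move=> k /andP[ki kj]; rewrite /f !ifF//; exact/negbTE.
rewrite integral_power_prob; last 2 first.
- move=> k; rewrite /f; case: (k == i :> nat) => //; case: (k == j :> nat) =>
  //.
- by move=> k v; rewrite /f; case: ifP => // _; case: ifP.
have f1 (k : 'I_n) : k != i -> k != j -> (\int[P]_v (f k v)%:E = 1)%E.
  move=> ki kj; have -> : f k = cst 1.
    by apply/funext => v; rewrite /f !ifF//; exact/negbTE.
  under eq_integral do rewrite /=.
  by rewrite integral_cst// mul1e; exact: probability_setT.
have fi : f i = g by apply/funext => v; rewrite /f eqxx.
have fj : f j = h.
  apply/funext => v; rewrite /f eqxx ifF//; apply/negbTE.
  by rewrite eq_sym.
rewrite (bigD1 i)//= (bigD1 j) 1?eq_sym//= big1.
  by rewrite mule1 fi fj.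
by move=> k /andP[ki kj]; exact: f1.
Qed.

End product_formula.

Lemma prodr_itv01 (R : numDomainType) (I : finType) (f : I -> R) :
  (forall i, 0 <= f i <= 1) -> 0 <= \prod_i f i <= 1.
Proof.
move=> f01; elim/big_ind : _ => // [|x y /andP[? ?] /andP[? ?]].
  by rewrite ler01 lexx.
by rewrite mulr_ge0//= mulr_ile1.
Qed.

Lemma measurable_orthant (R : realType) (n : nat) :
  measurable (@orthant R n).
Proof.
rewrite (_ : @orthant R n = \bigcap_(i in [set: 'I_n])
    ((fun a : Rn R n => tnth a i) @^-1` `[0, +oo[%classic)).
  apply: fin_bigcap_measurable => // i _.
  by rewrite -[X in measurable X]setTI; exact: measurable_tnth.
apply/seteqP; split => [a Oa i _|a Oa i] /=; first by rewrite in_itv/= Oa.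
by have := Oa i I; rewrite /= in_itv/= andbT.
Qed.

(** * The operator on laws that corresponds to [Gamma_] *)

Definition unif01 (R : realType) : probability (measurableTypeR R) R :=
  uniform_prob (@ltr01 R).

Lemma integral_unif01 (R : realType) (f : measurableTypeR R -> \bar R) :
  measurable_fun setT f -> (forall u, (0 <= f u)%E) ->
  (\int[unif01 R]_u f u = \int[lebesgue_measure]_(u in `[0%R, 1%R]) f u)%E.
Proof.
by move=> mf f0; rewrite /unif01 integral_uniform// subr0 invr1 mul1e.
Qed.

Section weighted_sum.
Context (R : realType) (m : R) (n : nat).

Definition weighted_sum (w : measurableTypeR R * Rn R n * Rn R n) :
    measurableTypeR R :=
  w.1.1 `^ m * \sum_(k < n) `|tnth w.1.2 k| * `|tnth w.2 k|.

Let measurable_weighted_sum : measurable_fun setT weighted_sum.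
Proof.
apply: measurable_funM.
  have h : measurable_fun setT (fun w : measurableTypeR R * Rn R n * Rn R n =>
    w.1.1).
    exact: (measurableT_comp measurable_fst measurable_fst).
  exact: (measurableT_comp (measurable_powR m) h).
apply: measurable_sum => k; apply: measurable_funM.
  apply: measurableT_comp => //; apply: (measurableT_comp (measurable_tnth k)).
  exact: (measurableT_comp measurable_snd measurable_fst).
apply: measurableT_comp => //; apply: (measurableT_comp (measurable_tnth k)).
exact: measurable_snd.
Qed.

HB.instance Definition _ := isMeasurableFun.Build _ _ _ _ weighted_sum
  measurable_weighted_sum.

End weighted_sum.

(* If [X_1, ..., X_n] are independent of law [P], this is the law of
   [U^m (a_1 X_1 + ... + a_n X_n)] with [U] uniform on [[0, 1]], [n] drawn with
   the weights [alpha] and [a] with law [A n]: [Gamma_] acts on Laplace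
   transforms as [step] acts on laws. Absolute values make the restrictions to
   the half-line and to the orthant unnecessary. *)
Section step.
Context (R : realType) (N : nat).
Variables (alpha : nat -> {nonneg R}) (A : forall n, probability (Rn R n) R).
Hypothesis alpha_sum : \sum_(n < N) (alpha n.+1)%:num = 1.
Variable m : R.

Section step_measure.
Variable P : probability (measurableTypeR R) R.

Let law (n : nat) : {measure set (measurableTypeR R) -> \bar R} :=
  mscale (alpha n.+1)
    (distribution (prod_prob (prod_prob (unif01 R) (A n.+1)) (power_prob P
      n.+1))
       (@weighted_sum R m n.+1)).

Let law_setT : msum law N [set: R] = 1%E.
Proof.
transitivity (\sum_(n < N) ((alpha n.+1)%:num)%:E)%E.
  rewrite [LHS](_ : _ = \sum_(n < N) law n [set: R])%E//.
  apply: eq_bigr => n _; rewrite -[RHS]mule1; congr (_ * _)%E.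
  exact: probability_setT.
by rewrite sumEFin alpha_sum.
Qed.

Definition step : probability (measurableTypeR R) R :=
  HB.pack (msum law N) (Measure_isProbability.Build _ _ _ (msum law N)
    law_setT).

Lemma integral_step (f : R -> \bar R) :
  measurable_fun setT f -> (forall v, (0 <= f v)%E) ->
  (\int[step]_v f v = \sum_(n < N) ((alpha n.+1)%:num)%:E *
     \int[unif01 R]_u \int[A n.+1]_a \int[power_prob P n.+1]_x
       f (u `^ m * \sum_(k < n.+1) `|tnth a k| * `|tnth x k|)%R)%E.
Proof.
move=> mf f0; rewrite [LHS](_ : _ = \int[msum law N]_v f v)%E//.
rewrite ge0_integral_measure_sum//; apply: eq_bigr => n _.
rewrite ge0_integral_mscale//; congr (_ * _)%E.
rewrite ge0_integral_distribution//.
have mg : measurable_fun setT (f \o @weighted_sum R m n.+1).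
  exact: (measurableT_comp mf (measurable_funPT (@weighted_sum R m n.+1))).
rewrite ge0_integral_prod_prob//; last by move=> w; exact: f0.
rewrite ge0_integral_prod_prob//.
  apply: (measurable_fun_fubini_tonelli_F (m2 := power_prob P n.+1)
    (f \o @weighted_sum R m n.+1)) => //.
  by move=> w; exact: f0.
by move=> w; apply: integral_ge0 => x _; exact: f0.
Qed.

End step_measure.

(** The conditional Laplace transform of $U^m\sum_k|a_k||X_k|$ given $U$ and the coefficients $a$: a
    product, by independence of the $X_k$. *)
Definition laplace_prod (P : probability (measurableTypeR R) R) (x : R) n
    (w : measurableTypeR R * Rn R n) : R :=
  \prod_(k < n) laplace_rv P Num.norm (x * w.1 `^ m * `|tnth w.2 k|).

Section step_laplace.
Variable P : probability (measurableTypeR R) R.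
Hypothesis A_orthant : forall n, (n < N)%N -> A n.+1 (@orthant R n.+1) = 1%E.

Let L := laplace_rv P Num.norm.

Let mnormr : measurable_fun setT (@Num.norm R R).
Proof. exact: normr_measurable. Qed.

(** The absolute value keeps the integrand in $[0,1]$ for negative [y] as well, so that Fubini gives
    measurability on the whole line. *)
Let measurable_L : measurable_fun setT (fun y : R => L `|y|).
Proof.
have m1 : measurable_fun setT
    (fun w : measurableTypeR R * measurableTypeR R => expR (- (`|w.1| *
      `|w.2|))).
  apply: measurableT_comp => //; apply: measurableT_comp => //.
  apply: measurable_funM; first exact: (measurableT_comp mnormr measurable_fst).
  exact: (measurableT_comp mnormr measurable_snd).
apply: (measurable_Rintegral1 (C := 1) P P m1) => w.
by rewrite ger0_norm ?expR_ge0// -expR0 ler_expR oppr_le0 mulr_ge0.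
Qed.

Local Notation h := (laplace_prod P).

Lemma measurable_laplace_prod x (n : nat) : 0 <= x -> measurable_fun setT (h x
  (n:=n)).
Proof.
move=> x0; apply: measurable_prod => k _.
apply: (eq_measurable_fun ((fun y : R => L `|y|) \o
    (fun w : measurableTypeR R * Rn R n => x * w.1 `^ m * `|tnth w.2 k|))).
  move=> w _ /=; rewrite [X in L X]ger0_norm//.
  by rewrite !mulr_ge0// powR_ge0.
apply: (measurableT_comp measurable_L); apply: measurable_funM.
  apply: measurable_funM; first exact: measurable_cst.
  exact: (measurableT_comp (measurable_powR m) measurable_fst).
apply: (measurableT_comp mnormr); apply: (measurableT_comp (measurable_tnth k)).
exact: measurable_snd.
Qed.

Lemma laplace_prod_itv01 x n (w : measurableTypeR R * Rn R n) : 0 <= x -> 0 <=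
  h x w <= 1.
Proof.
move=> x0; rewrite /laplace_prod.
have L01 (k : 'I_n) : 0 <= L (x * w.1 `^ m * `|tnth w.2 k|) <= 1.
  apply: laplace_rv_itv01 => //.
  by rewrite !mulr_ge0// powR_ge0.
exact: prodr_itv01.
Qed.

Lemma laplace_prod_norm x n (w : measurableTypeR R * Rn R n) : 0 <= x -> `|h x
  w| <= 1.
Proof. by move=> x0; have /andP[? ?] := laplace_prod_itv01 w x0; rewrite
  ger0_norm. Qed.

Let mh2 x (n : nat) (t : R) : 0 <= x -> measurable_fun setT (fun a => h x (t,
  a : Rn R n)).
Proof.
by move=> x0; exact: (measurableT_comp (@measurable_laplace_prod x n x0)
  (measurable_pair1 t)).
Qed.

Let integral_laplace_prod (x : R) : 0 <= x ->
  (\int[step P]_v (expR (- (x * `|v|)))%:E =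
   \sum_(n < N) ((alpha n.+1)%:num)%:E *
     \int[unif01 R]_t \int[A n.+1]_a (h x (t, a))%:E)%E.
Proof.
move=> x0; rewrite integral_step; last 2 first.
- apply/measurable_EFinP; exact: measurable_expRN.
- by move=> v; rewrite lee_fin expR_ge0.
apply: eq_bigr => n _; congr mule.
apply: eq_integral => t _; apply: eq_integral => a _; apply/esym.
pose f (k : nat) (v : R) := expR (- ((x * t `^ m * `|nth 0 a k|) * `|v|)).
have c0 k : 0 <= x * t `^ m * `|nth 0 a k| by rewrite !mulr_ge0// powR_ge0.
have mf k : measurable_fun setT (f k) by exact: measurable_expRN.
have f01 k v : 0 <= f k v <= 1
  by rewrite expR_ge0/= -expR0 ler_expR oppr_le0 mulr_ge0.
have fE (v : n.+1.-tuple R) : expR (- (x *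
    `|t `^ m * \sum_(k < n.+1) `|tnth a k| * `|tnth v k| |)) =
    \prod_(k < n.+1) f k (tnth v k).
  rewrite -expR_sum; congr expR; rewrite ger0_norm; last first.
    by rewrite mulr_ge0 ?powR_ge0// sumr_ge0// => k _; rewrite mulr_ge0.
  rewrite mulrA mulr_sumr -sumrN; apply: eq_bigr => k _.
  by rewrite (tnth_nth 0) mulrA.
under eq_integral => v _ do rewrite fE.
rewrite -(@EFin_Rintegral _ _ _ _ _ 1); last 2 first.
- by apply: measurable_prod => k _; exact: (@measurable_tnth_fun _ _ _ n.+1 f
  k (mf k)).
- move=> v; have /andP[] : 0 <= \prod_(k < n.+1) f k (tnth v k) <= 1.
    by apply: prodr_itv01 => k; exact: f01.
  by move=> p0 p1; rewrite ger0_norm.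
rewrite (@Rintegral_power_prob _ _ _ P n.+1 f mf f01).
apply: (congr1 EFin); apply: eq_bigr => k _.
by rewrite /L /laplace_rv (tnth_nth 0).
Qed.

(** Integrating $U$ and $a$ jointly allows a single use of dominated convergence in
    [cvg_laplace_step]; [Gamma_step] instead works with the iterated form in which [Gamma_] is
    written. *)
Lemma laplace_step (x : R) : 0 <= x ->
  laplace_rv (step P) Num.norm x = \sum_(n < N) (alpha n.+1)%:num *
    \int[prod_prob (unif01 R) (A n.+1)]_w laplace_prod P x w.
Proof.
move=> x0; rewrite /laplace_rv/= /Rintegral integral_laplace_prod//.
rewrite [X in fine X](_ : _ = (\sum_(n < N) (alpha n.+1)%:num *
    \int[prod_prob (unif01 R) (A n.+1)]_w laplace_prod P x w)%:E)//.
rewrite -sumEFin; apply: eq_bigr => n _; rewrite EFinM; congr mule.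
rewrite (@EFin_Rintegral _ _ _ _ _ 1); last 2 first.
- exact: measurable_laplace_prod.
- by move=> w; exact: laplace_prod_norm.
rewrite ge0_integral_prod_prob//.
  by apply/measurable_EFinP; exact: measurable_laplace_prod.
by move=> w /=; rewrite lee_fin; have /andP[] := laplace_prod_itv01 w x0.
Qed.

Lemma Gamma_step (u : R -> R) (x : R) :
  (forall y, 0 <= y -> u y = laplace_rv P Num.norm y) -> 0 <= x ->
  Gamma_ N alpha A m u x = laplace_rv (step P) Num.norm x.
Proof.
move=> uL x0.
rewrite [RHS]/laplace_rv/= /Rintegral integral_laplace_prod//.
rewrite /Gamma_ /Gamma /Rintegral; congr fine.
pose G t := \sum_(n < N) (alpha n.+1)%:num * \int[A n.+1]_a h x (t, a).
transitivity (\int[lebesgue_measure]_(t in `[0%R, 1%R]) (G t)%:E)%E.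
  apply: eq_integral => t _; congr EFin; apply: eq_bigr => n _; congr (_ * _).
  have mt := @mh2 x n.+1 t x0.
  have mtO : measurable_fun (@orthant R n.+1) (fun a => h x (t, a)).
    exact: measurable_funTS mt.
  have E := prob_eq_Rintegral (@measurable_orthant R n.+1)
    (A_orthant (ltn_ord n)) mtO mt (fun _ _ => erefl).
  rewrite -E; apply: eq_Rintegral => a; rewrite inE => Oa.
  apply: eq_bigr => k _; rewrite uL; last first.
    by rewrite !mulr_ge0// ?powR_ge0//; exact: Oa.
  by rewrite /L ger0_norm 1?mulrC//; exact: Oa.
rewrite -integral_unif01; last 2 first.
- apply/measurable_EFinP; apply: measurable_sum => n.
  apply: measurable_funM; first exact: measurable_cst.
  apply: (measurable_Rintegral1 (C := 1) (unif01 R) (A n.+1)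
    (measurable_laplace_prod x0)).
  by move=> w; exact: laplace_prod_norm.
- move=> t; rewrite lee_fin sumr_ge0// => n _; rewrite mulr_ge0//.
  by apply: Rintegral_ge0 => a _; have /andP[] := laplace_prod_itv01 (t, a) x0.
under eq_integral => t _ do rewrite -sumEFin.
have nneg n (t : measurableTypeR R) :
    (0 <= \int[A n.+1]_a (h x (t, a))%:E)%E.
  by apply: integral_ge0 => a _; rewrite lee_fin; have /andP[] :=
    laplace_prod_itv01 (t, a) x0.
have EA n (t : measurableTypeR R) : (\int[A n.+1]_a h x (t, a))%:E =
    (\int[A n.+1]_a (h x (t, a))%:E)%E.
  apply: (@EFin_Rintegral _ _ _ _ _ 1); first exact: mh2.
  by move=> a; exact: laplace_prod_norm.
have mE n : measurable_fun setT (fun t : measurableTypeR R =>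
    \int[A n.+1]_a (h x (t, a))%:E)%E.
  apply: (measurable_fun_fubini_tonelli_F (m2 := A n.+1)
    (fun w => (h x w)%:E)).
    apply/measurable_EFinP; exact: (@measurable_laplace_prod x n.+1 x0).
  by move=> w /=; rewrite lee_fin; have /andP[] := laplace_prod_itv01 w x0.
under eq_integral => t _.
  under eq_bigr => n _ do rewrite EFinM EA.
  over.
rewrite ge0_integral_sum//.
- by apply: eq_bigr => n _; rewrite ge0_integralZl.
- move=> n; apply: emeasurable_funM; first exact: measurable_cst.
  exact: mE.
- by move=> n t _; rewrite mule_ge0.
Qed.

End step_laplace.
End step.

(** * Continuity of [step] on transforms, and the fixed-point equation *)

Lemma cvg_sum_ord (R : realType) (n : nat) (f : 'I_n -> nat -> R) (l : 'I_n ->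
  R) :
  (forall i, f i k @[k --> \oo] --> l i) ->
  \sum_(i < n) f i k @[k --> \oo] --> \sum_(i < n) l i.
Proof.
elim: n f l => [|n IHn] f l fl.
  by under eq_cvg do rewrite big_ord0; rewrite big_ord0; exact: cvg_cst.
under eq_cvg do rewrite big_ord_recl; rewrite big_ord_recl.
by apply: cvgD; [exact: fl|exact: IHn].
Qed.

Lemma cvg_prod_ord (R : realType) (n : nat) (f : 'I_n -> nat -> R) (l : 'I_n
  -> R) :
  (forall i, f i k @[k --> \oo] --> l i) ->
  \prod_(i < n) f i k @[k --> \oo] --> \prod_(i < n) l i.
Proof.
elim: n f l => [|n IHn] f l fl.
  by under eq_cvg do rewrite big_ord0; rewrite big_ord0; exact: cvg_cst.
under eq_cvg do rewrite big_ord_recl; rewrite big_ord_recl.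
by apply: cvgM; [exact: fl|exact: IHn].
Qed.

Section fixed_point.
Context (R : realType) (N : nat).
Variables (alpha : nat -> {nonneg R}) (A : forall n, probability (Rn R n) R).
Hypothesis alpha_sum : \sum_(n < N) (alpha n.+1)%:num = 1.
Hypothesis A_orthant : forall n, (n < N)%N -> A n.+1 (@orthant R n.+1) = 1%E.

Lemma cvg_laplace_step (m : R) (P_ : nat -> probability (measurableTypeR R) R)
    (Q : probability (measurableTypeR R) R) :
  (forall x, 0 <= x -> laplace_rv (P_ k) Num.norm x @[k --> \oo] -->
    laplace_rv Q Num.norm x) ->
  forall x, 0 <= x ->
    laplace_rv (step A alpha_sum m (P_ k)) Num.norm x @[k --> \oo] -->
    laplace_rv (step A alpha_sum m Q) Num.norm x.
Proof.
move=> PQ x x0.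
rewrite laplace_step//; under eq_cvg do rewrite laplace_step//.
apply: cvg_sum_ord => n; apply: cvgM; first exact: cvg_cst.
apply: (@cvg_Rintegral_bounded _ _ _ _ _ _ 1).
- by move=> k; exact: measurable_laplace_prod.
- by move=> k w; exact: laplace_prod_norm.
- move=> w; apply: cvg_prod_ord => i; apply: PQ.
  by rewrite !mulr_ge0// powR_ge0.
Qed.

Let m := mu N alpha A 1.

(** The Dirac mass at 1 has the transform $e^{-x}$, which is the initial function $\psi^{(0)}$ for
    $p=1$. *)
Definition step_iterate (n : nat) : probability (measurableTypeR R) R :=
  iter n (step A alpha_sum m) (dirac (1 : measurableTypeR R)).

Lemma profile_iterate_laplace n (x : R) : 0 <= x ->
  profile_iterate N alpha A 1 n x = laplace_rv (step_iterate n) Num.norm x.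
Proof.
elim: n x => [|n IHn] x x0 /=.
  rewrite powRr1// /laplace_rv /Rintegral integral_dirac//.
    by rewrite diracT mul1e normr1 mulr1.
  by apply/measurable_EFinP; apply: measurable_expRN; exact: normr_measurable.
exact: Gamma_step.
Qed.

Lemma profile_fixed_point (Q : probability (measurableTypeR R) R) (psi : R ->
  R) :
  self_similar_profile N alpha A 1 psi ->
  (forall x, 0 <= x -> psi x = laplace_rv Q Num.norm x) ->
  (forall x, 0 <= x -> laplace_rv (step_iterate n) Num.norm x @[n --> \oo] -->
    laplace_rv Q Num.norm x) /\
  (forall x, 0 <= x -> laplace_rv (step A alpha_sum m Q) Num.norm x =
    laplace_rv Q Num.norm x).
Proof.
move=> psiP psiQ.
have PQ x : 0 <= x -> laplace_rv (step_iterate n) Num.norm x @[n --> \oo] -->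
    laplace_rv Q Num.norm x.
  move=> x0; rewrite -psiQ//.
  by under eq_cvg do rewrite -profile_iterate_laplace//; exact: psiP.
split=> // x x0.
(* The shifted sequence $u_{n+1}$ has two limits: [step] applied to [Q], by continuity, and [Q]
   itself. *)
pose u n := laplace_rv (step_iterate n) Num.norm x.
have c1 : u n.+1 @[n --> \oo] --> laplace_rv (step A alpha_sum m Q) Num.norm x.
  exact: (cvg_laplace_step (m := m) PQ x0).
have c2 : u n.+1 @[n --> \oo] --> laplace_rv Q Num.norm x.
  by rewrite (cvg_shiftS u); exact: PQ.
by apply: (cvg_unique (@Rhausdorff R) c1 c2).
Qed.

End fixed_point.

(** * Moments against the order of [ldiff] at 0 *)

Section moment_criteria.
Context (R : realType) d (T : measurableType d) (P : probability T R).
Variable X : T -> R.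
Hypotheses (mX : measurable_fun setT X) (X0 : forall w, 0 <= X w).

Lemma measurable_powR_rv (s : R) : measurable_fun setT (fun w => X w `^ s).
Proof. exact: (measurableT_comp (measurable_powR s) mX). Qed.

Lemma EFin_ldiff k y : 0 <= y ->
  ((ldiff P X k y 0)%:E = \int[P]_w ((1 - expR (- (y * X w))) ^+ k)%:E)%E.
Proof.
move=> y0; rewrite (@EFin_Rintegral _ _ _ _ _ 1); last 2 first.
- exact: measurable_ldiff_fun.
- by move=> w; exact: ldiff_fun_norm.
by apply: eq_integral => w _; rewrite mul0r oppr0 expR0 mul1r.
Qed.

Lemma onem_expRN_itv01 y w : 0 <= y -> 0 <= 1 - expR (- (y * X w)) <= 1.
Proof.
move=> y0; have /andP[e0 e1] := expRN_itv01 X0 w y0.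
by rewrite subr_ge0 e1/= lerBlDr lerDl.
Qed.

(** Since $1-e^{-u}\le\min(u,1)$ and $s\le k$, the [k]-th power is at most $u^k\le u^s$ for $u\le1$,
    and at most $1\le u^s$ beyond. *)
Lemma expR_onem_le_powR (u s : R) k : 0 <= u -> 0 < s -> s <= k%:R ->
  (1 - expR (- u)) ^+ k <= u `^ s.
Proof.
move=> u0 s0 sk.
have e1 : expR (- u) <= 1 by rewrite -expR0 ler_expR oppr_le0.
have a0 : 0 <= 1 - expR (- u) by rewrite subr_ge0.
have a1 : 1 - expR (- u) <= 1 by rewrite lerBlDr lerDl expR_ge0.
have [u1|/ltW u1] := leP u 1; last first.
  apply: (@le_trans _ _ 1); first exact: exprn_ile1.
  by rewrite -(powRr0 u) ler_powR// ltW.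
have := expR_ge1Dx (- u).
have [->|un0] := eqVneq u 0.
  move=> _; rewrite oppr0 expR0 subrr.
  case: k sk => [|k _]; last by rewrite expr0n/= powR_ge0.
  by move=> /(lt_le_trans s0); rewrite ltxx.
have {un0}u_gt0 : 0 < u by rewrite lt_neqAle eq_sym un0.
move=> h; apply: (@le_trans _ _ (u ^+ k)).
  by rewrite lerXn2r ?nnegrE//; lra.
by rewrite -powR_mulrn// ger_powR// u_gt0.
Qed.

Lemma ldiff_le_moment k y s : 0 < s -> s <= k%:R -> 0 <= y ->
  ((ldiff P X k y 0)%:E <= (y `^ s)%:E * \int[P]_w (X w `^ s)%:E)%E.
Proof.
move=> s0 sk y0; rewrite EFin_ldiff//.
rewrite -ge0_integralZl//; last 3 first.
- exact/measurable_EFinP/measurable_powR_rv.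
- by move=> w _; rewrite lee_fin powR_ge0.
- by rewrite lee_fin powR_ge0.
apply: ge0_le_integral => //.
- by move=> w _; rewrite lee_fin exprn_ge0//; have /andP[] := onem_expRN_itv01
  w y0.
- apply/measurable_EFinP; apply: measurable_funX; apply: measurable_funB.
    exact: measurable_cst.
  exact: measurable_expRN.
- apply/measurable_EFinP; apply: measurable_funM; first exact: measurable_cst.
  exact: measurable_powR_rv.
- move=> w _; rewrite -EFinM lee_fin -powRM//.
  by apply: expR_onem_le_powR => //; rewrite mulr_ge0.
Qed.

(* Between [e^j] and [e^(j+1)] the power [x^s] is dominated by the j-th term
   [e^(s j) (1 - exp(- e^(-j) x))^k] up to a constant, and a bound on [ldiff]
   makes the sum of the integrals geometric. *)
Lemma moment_lty_of_ldiff k (B s t : R) : 0 < s -> s < t -> 0 <= B ->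
  (forall y, 0 < y -> ldiff P X k y 0 <= B * y `^ t) ->
  (\int[P]_w (X w `^ s)%:E < +oo)%E.
Proof.
move=> s0 st B0 DB.
pose f (j : nat) w := (1 - expR (- (expR (- j%:R) * X w))) ^+ k.
(* For $e^j\le x\le e^{j+1}$ one has $x^s\le e^se^{js}$, while $e^{-j}x\ge1$ makes the [j]-th factor
   at least $b^k$; this dictates [c]. Values $x\le1$ are absorbed by the constant 1 in [Xg]. *)
pose b : R := 1 - expR (- 1).
have b0 : 0 < b by rewrite subr_gt0 -expR0 ltr_expR oppr_lt0.
pose c := expR s / b ^+ k.
have c0 : 0 < c by rewrite divr_gt0 ?expR_gt0// exprn_gt0.
have f0 j w : 0 <= f j w.
  by rewrite exprn_ge0//; have /andP[] := onem_expRN_itv01 w (expR_ge0 (-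
    j%:R)).
have mf j : measurable_fun setT (f j).
  apply: measurable_funX; apply: measurable_funB; first exact: measurable_cst.
  exact: measurable_expRN.
pose g (j : nat) w := (c * expR (j%:R * s) * f j w)%:E.
have g0 j w : (0 <= g j w)%E.
  by rewrite lee_fin mulr_ge0// mulr_ge0 ?expR_ge0// ltW.
have mg j : measurable_fun setT (g j).
  by apply/measurable_EFinP; apply: measurable_funM => //; exact:
    measurable_cst.
have gS w : (0 <= \sum_(0 <= j <oo) g j w)%E.
  by apply: nneseries_ge0 => j _ _; exact: g0.
have mgS : measurable_fun setT (fun w => \sum_(0 <= j <oo) g j w)%E.
  by apply: ge0_emeasurable_sum => // j w _ _; exact: g0.
have Xg w : ((X w `^ s)%:E <= 1 + \sum_(0 <= j <oo) g j w)%E.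
  have [X1|X1] := leP (X w) 1.
    apply: (@le_trans _ _ 1%E); last by rewrite leeDl.
    have p1 : 1 `^ s = 1 :> R by rewrite powR1.
    rewrite lee_fin -p1.
    by apply: (ge0_ler_powR (ltW s0)); rewrite ?nnegrE.
  have Xgt0 : 0 < X w by exact: lt_trans X1.
  have lnX0 : 0 <= ln (X w) by rewrite ln_ge0// ltW.
  have /andP[jX Xj] := truncn_itv lnX0.
  set j := Num.Def.trunc _ in jX Xj.
  apply: (@le_trans _ _ (g j w)); last first.
    apply: (@le_trans _ _ (\sum_(0 <= i <oo) g i w)%E); last by rewrite leeDr.
    apply: le_trans (nneseries_lim_ge j.+1 _); last by move=> *; exact: g0.
    rewrite big_nat_recr//= leeDr// sume_ge0// => i _; exact: g0.
  rewrite lee_fin /powR gt_eqF//.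
  apply: (@le_trans _ _ (expR s * expR (j%:R * s))).
    rewrite -expRD ler_expR mulrC -{2}(mul1r s) -mulrDl ler_wpM2r ?(ltW s0)//.
    by rewrite addrC natr1 ltW.
  have bf : b ^+ k <= f j w.
    rewrite lerXn2r ?nnegrE ?(ltW b0)//.
      by have /andP[] := onem_expRN_itv01 w (expR_ge0 (- j%:R)).
    rewrite lerD2l lerN2 ler_expR lerN2 -[X in _ * X](lnK Xgt0) -expRD.
    by rewrite -[leLHS]expR0 ler_expR addrC subr_ge0.
  rewrite [leRHS](_ : _ = expR s * expR (j%:R * s) * (f j w / b ^+ k)); last
    first.
    by rewrite /c; ring.
  by rewrite ler_peMr ?mulr_ge0 ?expR_ge0// ler_pdivlMr ?exprn_gt0// mul1r.
apply: (@le_lt_trans _ _ (\int[P]_w (1 + \sum_(0 <= j <oo) g j w))%E).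
  apply: ge0_le_integral => //.
  - by move=> w _; rewrite lee_fin powR_ge0.
  - exact/measurable_EFinP/measurable_powR_rv.
  - by apply: emeasurable_funD => //; exact: measurable_cst.
rewrite ge0_integralD//.
rewrite integral_cst// mul1e; apply: lte_add_pinfty.
  by rewrite (le_lt_trans (probability_le1 _ _)) ?ltry.
rewrite integral_nneseries//.
(* The hypothesis at $y=e^{-j}$ bounds the [j]-th integral by $c\,e^{js}Be^{-jt}=cB\,q^j$, with
   $q<1$ because $s<t$. *)
pose q := expR (- (t - s)).
have q1 : `|q| < 1.
  by rewrite ger0_norm ?expR_ge0// -expR0 ltr_expR oppr_lt0 subr_gt0.
have cB : 0 <= c * B by rewrite mulr_ge0// ltW.
have gq j : (\int[P]_w g j w <= (geometric (c * B) q j)%:E)%E.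
  rewrite /g; under eq_integral do rewrite EFinM.
  rewrite ge0_integralZl//; last 3 first.
  - exact/measurable_EFinP/mf.
  - by move=> w _; rewrite lee_fin.
  - by rewrite lee_fin mulr_ge0 ?expR_ge0// ltW.
  rewrite -EFin_ldiff ?expR_ge0// -EFinM lee_fin.
  apply: (@le_trans _ _ (c * expR (j%:R * s) * (B * expR (- j%:R) `^ t))).
    rewrite ler_wpM2l ?DB ?expR_gt0// mulr_ge0 ?expR_ge0//; exact: ltW.
  rewrite /powR gt_eqF ?expR_gt0// expRK /geometric/= /q -expRM_natl.
  rewrite [leLHS](_ : _ = c * B * (expR (j%:R * s) * expR (t * - j%:R))); last
    by ring.
  rewrite -expRD; apply: ler_wpM2l => //; rewrite ler_expR.
  by rewrite le_eqVlt; apply/orP; left; apply/eqP; ring.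
apply: (@le_lt_trans _ _ (c * B / (1 - q))%:E); last exact: ltry.
apply: lime_le.
  by apply: is_cvg_nneseries => j _ _; apply: integral_ge0.
apply: nearW => n.
apply: (@le_trans _ _ (\sum_(0 <= j < n) (geometric (c * B) q j)%:E)%E).
  by apply: lee_sum => j _; exact: gq.
rewrite sumEFin lee_fin; apply: geometric_le_lim => //.
exact: expR_gt0.
Qed.

End moment_criteria.

(** * The case $p<1$: variables whose transform at $x$ is that of a mean-one variable at $x^p$ *)

Lemma cvg_expRN_natmul (R : realType) (c : R) : 0 < c ->
  expR (- (n%:R * c)) @[n --> \oo] --> (0 : R).
Proof.
move=> c0; have e1 : `|expR (- c)| < 1.
  by rewrite ger0_norm ?expR_ge0// -expR0 ltr_expR oppr_lt0.
have := cvg_geometric (1 : R) e1; apply: cvg_trans; apply: near_eq_cvg.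
by apply: nearW => n; rewrite /geometric/= mul1r -mulrN expRM_natl.
Qed.

Section stable_law_moments.
Context (R : realType) d1 d2 (T1 : measurableType d1) (T2 : measurableType d2).
Variables (P : probability T1 R) (Q : probability T2 R).
Variables (X : T1 -> R) (Y : T2 -> R).
Hypotheses (mX : measurable_fun setT X) (X0 : forall w, 0 <= X w).
Hypotheses (mY : measurable_fun setT Y) (Y0 : forall w, 0 <= Y w).

Lemma ldiff1 d (T : measurableType d) (P' : probability T R) (Z : T -> R) y :
  measurable_fun setT Z -> (forall w, 0 <= Z w) -> 0 <= y ->
  ldiff P' Z 1 y 0 = laplace_rv P' Z 0 - laplace_rv P' Z y.
Proof. by move=> mZ Z0 y0; rewrite ldiffS// !ldiff0 add0r. Qed.

Lemma integral_powR_le1D d (T : measurableType d) (P' : probability T R)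
    (Z : T -> R) (s t : R) :
  measurable_fun setT Z -> (forall w, 0 <= Z w) -> 0 <= s -> s <= t ->
  (\int[P']_w (Z w `^ s)%:E <= 1 + \int[P']_w (Z w `^ t)%:E)%E.
Proof.
move=> mZ Z0 s0 st.
apply: (@le_trans _ _ (\int[P']_w (1 + (Z w `^ t)%:E))%E); last first.
  rewrite ge0_integralD//.
  - by rewrite integral_cst// mul1e leeD2r// probability_le1.
  - by move=> w _; rewrite lee_fin powR_ge0.
  - exact/measurable_EFinP/measurable_powR_rv.
apply: ge0_le_integral => //.
- by move=> w _; rewrite lee_fin powR_ge0.
- exact/measurable_EFinP/measurable_powR_rv.
- apply: emeasurable_funD; first exact: measurable_cst.
  exact/measurable_EFinP/measurable_powR_rv.
move=> w _; rewrite -EFinD lee_fin.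
have [Z1|/ltW Z1] := leP (Z w) 1.
  apply: (@le_trans _ _ 1); last by rewrite lerDl powR_ge0.
  have p1 : 1 `^ s = 1 :> R by rewrite powR1.
  by rewrite -[leRHS]p1; apply: (ge0_ler_powR s0); rewrite ?nnegrE.
by apply: (@le_trans _ _ (Z w `^ t)); [exact: ler_powR|rewrite lerDr].
Qed.

Hypothesis EY : (\int[Q]_w (Y w)%:E = 1)%E.
Variable p : R.
Hypotheses (p0 : 0 < p) (p1 : p < 1).
Hypothesis XY : forall x, 0 <= x -> laplace_rv P X x = laplace_rv Q Y (x `^ p).

Let ldiffXY y : 0 <= y -> ldiff P X 1 y 0 = ldiff Q Y 1 (y `^ p) 0.
Proof.
move=> y0; rewrite (ldiff1 P mX X0 y0) (ldiff1 Q mY Y0 (powR_ge0 y p)).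
by rewrite (XY (lexx 0)) (XY y0) powR0// gt_eqF.
Qed.

Let EY1 : (\int[Q]_w (Y w `^ 1)%:E = 1)%E.
Proof. by under eq_integral do rewrite powRr1//. Qed.

(** The first difference suffices: $E(1-e^{-yX})=E(1-e^{-y^pY})\le y^pE\,Y=y^p$, which is the tail
    criterion with exponent $p$. For $Y=1$ the variable $X$ is one-sided stable of index $p$. *)
Lemma stable_law_moment_lty s : 0 < s -> s < p ->
  (\int[P]_w (X w `^ s)%:E < +oo)%E.
Proof.
move=> s0 sp; apply: (moment_lty_of_ldiff mX X0 (k := 1) (B := 1) s0 sp) => //.
move=> y y0; rewrite ldiffXY ?(ltW y0)// mul1r -lee_fin.
have := @ldiff_le_moment _ _ _ Q _ mY Y0 1 (y `^ p) 1 ltr01 (lexx _) (powR_ge0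
  _ _).
by rewrite EY1 mule1 powRr1// powR_ge0.
Qed.

(** If $E\,X^p$ were finite, $(1-e^{-yX})/y^p$ would be dominated by $X^p$ and tend to 0 with $y$,
    because $p<1$. But its expectation is that of $(1-e^{-zY})/z$ with $z=y^p$, which tends to
    $E\,Y=1$. Both limits are taken along $y_n=e^{-n}$. *)
Lemma stable_law_moment_pinfty s : p <= s ->
  (\int[P]_w (X w `^ s)%:E = +oo)%E.
Proof.
move=> ps; apply/eqP; rewrite -leye_eq leNgt; apply/negP => Xs.
have Xp : (\int[P]_w (X w `^ p)%:E < +oo)%E.
  apply: le_lt_trans (integral_powR_le1D P mX X0 (ltW p0) ps) _.
  by rewrite lte_add_pinfty ?ltry.
pose z (n : nat) : R := expR (- (n%:R * p)).
pose y (n : nat) : R := expR (- n%:R).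
have yz n : y n `^ p = z n.
  by rewrite /powR gt_eqF ?expR_gt0// expRK /z mulrN mulrC.
have z0 n : 0 < z n by exact: expR_gt0.
have y0 n : 0 < y n by exact: expR_gt0.
have cz : z n @[n --> \oo] --> (0 : R) by exact: cvg_expRN_natmul.
have cyz : y n / z n @[n --> \oo] --> (0 : R).
  have p10 : 0 < 1 - p by rewrite subr_gt0.
  have := cvg_expRN_natmul p10; apply: cvg_trans; apply: near_eq_cvg.
  apply: nearW => n; rewrite /y /z [in X in _ = _ / X]expRN invrK -expRD;
    congr expR; ring.
pose a n w : \bar R := ((1 - expR (- (y n * X w))) / z n)%:E.
pose b n w : \bar R := ((1 - expR (- (z n * Y w))) / z n)%:E.
have onem0 x : 0 <= x -> 0 <= 1 - expR (- x) :> R.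
  by move=> x0; rewrite subr_ge0 -expR0 ler_expR oppr_le0.
have onem1 x : 1 - expR (- x) <= x :> R.
  by have := expR_ge1Dx (- x); lra.
have intE d (T : measurableType d) (P' : probability T R) (Z : T -> R) u v :
    measurable_fun setT Z -> (forall w, 0 <= Z w) -> 0 < u -> 0 < v ->
    (\int[P']_w ((1 - expR (- (u * Z w))) / v)%:E = (ldiff P' Z 1 u 0 /
      v)%:E)%E.
  move=> mZ Z0 u0 v0; rewrite mulrC EFinM EFin_ldiff ?(ltW u0)//.
  rewrite -ge0_integralZl//.
  - by apply: eq_integral => w _; rewrite -EFinM expr1 mulrC.
  - apply/measurable_EFinP; apply: measurable_funX; apply: measurable_funB.
      exact: measurable_cst.
    exact: measurable_expRN.
  - by move=> w _; rewrite lee_fin expr1 onem0// mulr_ge0// ltW.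
  - by rewrite lee_fin invr_ge0 ltW.
have mfun d (T : measurableType d) (Z : T -> R) u v : measurable_fun setT Z ->
    measurable_fun setT (fun w => ((1 - expR (- (u * Z w))) / v)%:E).
  move=> mZ; apply/measurable_EFinP; apply: measurable_funM.
    by apply: measurable_funB; [exact: measurable_cst|exact: measurable_expRN].
  exact: measurable_cst.
have ca : (\int[P]_w a n w)%E @[n --> \oo] --> (\int[P]_w (cst 0%E w))%E.
  apply: (@dominated_cvg _ _ _ _ _ _ _ _ (fun w => (X w `^ p)%:E)) => //.
  - by move=> n; exact: mfun.
  - move=> w _; apply: cvg_EFin; first exact: nearW.
    apply: (@squeeze_cvgr _ _ _ _ (cst 0) (fun n => X w * (y n / z n))).
    + apply: nearW => n /=; rewrite divr_ge0 ?(ltW (z0 n)) ?onem0//=.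
        by rewrite mulrA ler_wpM2r ?invr_ge0 ?(ltW (z0 n))// mulrC onem1.
      by rewrite mulr_ge0// ltW.
    + exact: cvg_cst.
    + by rewrite -[X in _ --> X](mulr0 (X w)); apply: cvgM => //; exact:
      cvg_cst.
  - apply/integrableP; split; first exact/measurable_EFinP/measurable_powR_rv.
    by under eq_integral => w _ do rewrite gee0_abs ?lee_fin ?powR_ge0//.
  - move=> n w _; rewrite gee0_abs ?lee_fin; last first.
      by rewrite divr_ge0 ?(ltW (z0 n))// onem0// mulr_ge0// ltW.
    rewrite ler_pdivrMr// mulrC -yz -powRM// ?(ltW (y0 n))//.
    rewrite -[leLHS]expr1; apply: expR_onem_le_powR => //; last exact: ltW.
    by rewrite mulr_ge0// ltW.
have cb : (\int[Q]_w b n w)%E @[n --> \oo] --> (\int[Q]_w (Y w)%:E)%E.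
  apply: (@dominated_cvg _ _ _ _ _ _ _ _ (fun w => (Y w)%:E)) => //.
  - by move=> n; exact: mfun.
  - move=> w _; apply: cvg_EFin; first exact: nearW.
    apply: (@squeeze_cvgr _ _ _ _ (fun n => Y w * (1 - z n * Y w)) (cst (Y w))).
    + apply: nearW => n /=; have u0 : 0 <= z n * Y w by rewrite mulr_ge0// ltW.
      rewrite ler_pdivlMr// ler_pdivrMr// [Y w * z n]mulrC onem1 andbT.
      rewrite mulrAC [Y w * z n]mulrC expRN; set u := z n * Y w in u0 *.
      have e1 := expR_ge1Dx u; have u1 : 0 < 1 + u by rewrite ltr_wpDr.
      (* Lower bound $1-e^{-u}\ge1-1/(1+u)=u/(1+u)\ge u(1-u)$. *)
      apply: (@le_trans _ _ (1 - (1 + u)^-1)); last first.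
        by rewrite lerD2l lerN2 lef_pV2 ?posrE ?expR_gt0.
      rewrite [leRHS](_ : _ = u / (1 + u)); last by field; rewrite gt_eqF.
      rewrite ler_pdivlMr// -mulrA ler_piMr//.
      by have := mulr_ge0 u0 u0; lra.
    + rewrite -[X in _ --> X]mulr1; apply: cvgM; first exact: cvg_cst.
      rewrite -[X in _ --> X](subr0 1) -[X in _ --> _ - X](mul0r (Y w)).
      apply: cvgB; first exact: cvg_cst.
      by apply: cvgM => //; exact: cvg_cst.
    + exact: cvg_cst.
  - apply/integrableP; split; first exact/measurable_EFinP.
    under eq_integral => w _ do rewrite gee0_abs ?lee_fin//.
    by rewrite EY ltry.
  - move=> n w _; rewrite gee0_abs ?lee_fin; last first.
      by rewrite divr_ge0 ?(ltW (z0 n))// onem0// mulr_ge0// ltW.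
    by rewrite ler_pdivrMr// mulrC onem1.
have ab : (fun n => \int[P]_w a n w)%E = (fun n => \int[Q]_w b n w)%E.
  apply/funext => n; rewrite intE// intE// ldiffXY ?yz//.
  exact: ltW.
rewrite ab in ca; have := cvg_unique (@ereal_hausdorff R) ca cb.
rewrite EY integral_cst// mul0e => /(_ _)/esym [].
by apply/eqP; rewrite oner_eq0.
Qed.

End stable_law_moments.

(** * Explicit integrals on the unit interval *)

Section improper_integral.
Context (R : realType).

(** A fundamental theorem for integrands that may be singular at 0: the growth condition on [F]
    replaces its boundary value there by 0, and the nonnegativity of [f] gives monotone convergence
    of the integrals over $[1/(n+1),1]$. *)
Lemma integral01_FTC (f F : R -> R) (C r : R) : 0 < r ->
  (forall x : R, 0 < x -> is_derive x (1 : R) F (f x)) ->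
  (forall x : R, 0 < x -> {for x, continuous f}) ->
  (forall x : R, 0 < x -> 0 <= f x) ->
  (forall x : R, 0 < x -> x <= 1 -> `|F x| <= C * x `^ r) ->
  (\int[lebesgue_measure]_(x in `[0%R, 1%R]) (f x)%:E = (F 1)%:E)%E.
Proof.
move=> r0 dF cf f0 FC.
pose D (n : nat) : set R := `[0 + n.+1%:R^-1, 1]%classic.
have D0 n x : D n x -> 0 < x.
  rewrite /D/= in_itv/= add0r => /andP[+ _]; apply: lt_le_trans.
  by rewrite invr_gt0.
have cfD n : {within D n, continuous f}.
  apply: continuous_in_subspaceT => x; rewrite inE => /D0; exact: cf.
have mf n : measurable_fun (D n) f.
  by apply: subspace_continuous_measurable_fun => //; exact: measurable_itv.
have mD n : measurable (D n) by exact: measurable_itv.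
have mfo : measurable_fun (`]0, 1] : set R) f.
  rewrite itv_open_bnd_bigcup; apply/measurable_fun_bigcup => //; exact: mf.
rewrite -integral_itv_obnd_cbnd; last exact/measurable_EFinP.
rewrite itv_open_bnd_bigcup.
have cD : (\int[lebesgue_measure]_(x in D n) (f x)%:E)%E @[n --> \oo] -->
    (\int[lebesgue_measure]_(x in \bigcup_n D n) (f x)%:E)%E.
  apply: ge0_nondecreasing_set_cvg_integral => //.
  - move=> m n mn; apply/subsetPset => x; rewrite /D/= !in_itv/= !add0r.
    move=> /andP[mx ->]; rewrite andbT (le_trans _ mx)//.
    by rewrite lef_pV2 ?posrE// ler_nat.
  - by move=> n; apply/measurable_EFinP; exact: (mf n).
  - by move=> n x Dx; rewrite lee_fin f0// (D0 n).
(* The index is shifted because [D 0] is the degenerate interval $[1,1]$. *)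
have FTC n : (\int[lebesgue_measure]_(x in D n.+1) (f x)%:E)%E =
    (F 1 - F n.+2%:R^-1)%:E.
  rewrite /D add0r (@continuous_FTC2 _ f F) //.
  - by rewrite invf_lt1// ltr1n.
  - by rewrite -[X in `[X, _]](add0r); exact: (cfD n.+1).
  - have n0 : 0 < n.+2%:R^-1 :> R by rewrite invr_gt0.
    have dc x : 0 < x -> {for x, continuous F}.
      by move=> x0; apply/differentiable_continuous/derivable1_diffP; case:
        (dF x x0).
    split.
    + move=> x; rewrite in_itv/= => /andP[nx _].
      by case: (dF x (lt_trans n0 nx)).
    + by apply: cvg_at_right_filter; exact: dc.
    + by apply: cvg_at_left_filter; exact: dc.
  - move=> x; rewrite in_itv/= => /andP[nx _].
    have x0 : 0 < x by apply: lt_trans nx; rewrite invr_gt0.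
    by rewrite derive1E; case: (dF x x0).
have cF : F n.+2%:R^-1 @[n --> \oo] --> (0 : R).
  apply/cvgr0Pnorm_le => e e0; near=> n.
  have n0 : 0 < n.+2%:R^-1 :> R by rewrite invr_gt0.
  apply: (le_trans (FC _ n0 _)); first by rewrite invf_le1// ler1n.
  pose M := (`|C| + 1)%R.
  have M0 : 0 < M by rewrite ltr_wpDl.
  apply: (@le_trans _ _ (M * n.+2%:R^-1 `^ r)).
    rewrite ler_wpM2r ?powR_ge0//.
    by rewrite (le_trans (ler_norm C))// lerDl.
  rewrite mulrC -ler_pdivlMr//.
  have eM : 0 < e / M by rewrite divr_gt0.
  have -> : e / M = ((e / M) `^ r^-1) `^ r.
    by rewrite -powRrM mulVf ?gt_eqF// powRr1// ltW.
  have b0 : 0 < (e / M) `^ r^-1 by rewrite powR_gt0.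
  apply: (ge0_ler_powR (ltW r0)); rewrite ?nnegrE ?(ltW n0) ?(ltW b0)//.
  rewrite -[leRHS]invrK lef_pV2 ?posrE ?invr_gt0//.
  apply: (@le_trans _ _ n%:R).
    by near: n; exact: nbhs_infty_ger.
  by rewrite ler_nat (leq_trans (leqnSn _)).
have cF1 : (F 1 - F n.+2%:R^-1)%:E @[n --> \oo] --> (F 1)%:E.
  apply: cvg_EFin; first exact: nearW.
  rewrite -[X in _ --> X]subr0; apply: cvgB; first exact: cvg_cst.
  exact: cF.
move: cD; rewrite -cvg_shiftS => cD.
have cD2 : (F 1 - F n.+2%:R^-1)%:E @[n --> \oo] -->
    (\int[lebesgue_measure]_(x in \bigcup_n D n) (f x)%:E)%E.
  by under eq_cvg do rewrite -FTC.
by apply: (cvg_unique (@ereal_hausdorff R) cD2 cF1).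
Unshelve. all: end_near. Qed.

End improper_integral.

Section unit_interval_integrals.
Context (R : realType).

Lemma unif01_itv : unif01 R `]0, 1]%classic = 1%E.
Proof.
have mI : measurable (`]0%R, 1%R]%classic : set (measurableTypeR R)).
  exact: measurable_itv.
rewrite -[in LHS](setIT `]0, 1]%classic) -integral_indic//.
rewrite integral_unif01; last 2 first.
- exact/measurable_EFinP/measurable_indic.
- by move=> u; rewrite lee_fin.
rewrite integral_indic//.
rewrite (_ : _ `&` _ = `]0, 1]%classic); last first.
  apply/seteqP; split => u /=; rewrite !in_itv/=; first by case.
  by move=> /andP[u0 ->]; rewrite u0 (ltW u0).
apply: etrans (lebesgue_measure_itv `]0%R, 1%R]) _.
by rewrite /= lte_fin ltr01 oppr0 adde0.
Qed.

(** The point 0 is left out because [ln] and [powR] take default values there that break the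
    identities wanted on $]0,1]$. *)
Lemma eq_integral_unif01 (f g : R -> \bar R) :
  measurable_fun setT f -> measurable_fun setT g ->
  (forall u : R, 0 < u -> u <= 1 -> f u = g u) ->
  (\int[unif01 R]_u f u = \int[unif01 R]_u g u)%E.
Proof.
move=> mf mg fg.
have mI : measurable (`]0%R, 1%R]%classic : set (measurableTypeR R)).
  exact: measurable_itv.
have E h : measurable_fun setT h -> {in `]0%R, 1%R]%classic, f =1 h} ->
    (\int[unif01 R]_(u in `]0%R, 1%R]) f u = \int[unif01 R]_u h u)%E.
  move=> mh fh; apply: (prob_eq_integral mI unif01_itv _ mh fh).
  exact: measurable_funTS mf.
rewrite -(E f mf)// (E g mg)// => u.
by rewrite inE/= in_itv/= => /andP[u0 u1]; exact: fg.
Qed.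

Lemma integral_unif01_powR (q : R) : - 1 < q ->
  (\int[unif01 R]_u (u `^ q)%:E = ((1 + q)^-1)%:E)%E.
Proof.
move=> q1; have q0 : 0 < 1 + q by lra.
rewrite integral_unif01; last 2 first.
- apply/measurable_EFinP; exact: measurable_powR.
- by move=> u; rewrite lee_fin powR_ge0.
pose F (u : R) := (1 + q)^-1 * u `^ (1 + q).
have dF (x : R) : 0 < x -> is_derive x (1 : R) F (x `^ q).
  move=> x0; have h := is_deriveZ (1 + q)^-1 (is_derive1_powR (1 + q) x0).
  apply: (is_derive_eq h).
  rewrite /GRing.scale/= mulrA mulVf ?gt_eqF// mul1r.
  by congr powR; ring.
have cf (x : R) : 0 < x -> {for x, continuous (fun u => u `^ q)}.
  move=> x0; apply/differentiable_continuous/derivable1_diffP.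
  by apply: derivable_powR; rewrite in_itv/= x0.
have FC (x : R) : 0 < x -> x <= 1 -> `|F x| <= (1 + q)^-1 * x `^ (1 + q).
  by move=> x0 x1; rewrite ger0_norm// mulr_ge0 ?powR_ge0// invr_ge0 ltW.
have := @integral01_FTC R _ F _ _ q0 dF cf (fun x _ => powR_ge0 x q) FC.
by rewrite /F powR1 mulr1.
Qed.

Lemma measurable_cos_ln (v : R) :
  measurable_fun setT (fun u : R => cos (v * ln u)).
Proof.
have mc : measurable_fun setT (@cos R).
  by apply: continuous_measurable_fun; exact: continuous_cos.
apply: (measurableT_comp mc); apply: measurable_funM; first exact:
  measurable_cst.
exact: measurable_ln.
Qed.

Lemma Rintegral_unif01_cos_ln (v : R) :
  \int[unif01 R]_u cos (v * ln u) = (1 + v ^+ 2)^-1.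
Proof.
have v0 : 0 < 1 + v ^+ 2 by rewrite ltr_wpDr// sqr_ge0.
have v1 : 1 + v ^+ 2 != 0 by rewrite gt_eqF.
have mc := measurable_cos_ln v.
(* $G/(1+v^2)$ is a primitive of $\cos(v\ln u)$. The integrand is taken as $1-\cos(v\ln u)$, with
   primitive [F], since [integral01_FTC] asks for nonnegativity. *)
pose G (u : R) := u * (cos (v * ln u) + v * sin (v * ln u)).
pose F (u : R) := u - (1 + v ^+ 2)^-1 * G u.
have dvln (x : R) : 0 < x -> is_derive x (1 : R) (fun u => v * ln u) (v / x).
  by move=> x0; have h := is_deriveZ v (is_derive1_ln x0); exact:
    (is_derive_eq h).
have E : (\int[unif01 R]_u (1 - cos (v * ln u))%:E = (F 1)%:E)%E.
  rewrite integral_unif01; last 2 first.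
  - apply/measurable_EFinP; apply: measurable_funB => //; exact: measurable_cst.
  - by move=> u; rewrite lee_fin subr_ge0 cos_le1.
  have dF (x : R) : 0 < x -> is_derive x (1 : R) F (1 - cos (v * ln x)).
    move=> x0.
    have dc := @is_derive1_comp R cos (fun u => v * ln u) x _ _ (is_derive_cos
      _) (dvln x x0).
    have ds := @is_derive1_comp R sin (fun u => v * ln u) x _ _ (is_derive_sin
      _) (dvln x x0).
    have dG := is_deriveM (is_derive_id x 1) (is_deriveD dc (is_deriveZ v ds)).
    have h := is_deriveB (is_derive_id x 1) (is_deriveZ (1 + v ^+ 2)^-1 dG).
    apply: (is_derive_eq h); rewrite /GRing.scale/=.
    rewrite /comp/= /GRing.scale/= !fctE/= -[v *: sin _]/(v * sin (v * ln x)).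
    by field; rewrite v1 gt_eqF.
  have cf (x : R) : 0 < x -> {for x, continuous (fun u => 1 - cos (v * ln u))}.
    move=> x0; apply: continuousB; first exact: cst_continuous.
    apply: (@continuous_comp _ _ _ (fun u => v * ln u) cos); last exact:
      continuous_cos.
    by apply: continuousM; [exact: cst_continuous|exact: continuous_ln].
  apply: (@integral01_FTC R _ F (1 + (1 + v ^+ 2)^-1 * (1 + `|v|)) 1 ltr01 dF
    cf).
    by move=> x x0; rewrite subr_ge0 cos_le1.
  move=> x x0 x1; rewrite powRr1 ?(ltW x0)//.
  apply: (le_trans (ler_normB _ _)).
  rewrite mulrDl mul1r (gtr0_norm x0) lerD2l normrM gtr0_norm ?invr_gt0//.
  rewrite -mulrA ler_wpM2l ?invr_ge0 ?(ltW v0)//.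
  rewrite /G normrM (gtr0_norm x0) mulrC ler_wpM2r ?(ltW x0)//.
  apply: (le_trans (ler_normD _ _)); apply: lerD; first exact: cos_max.
  by rewrite normrM ler_piMr// sin_max.
have cosb (u : R) : `|cos (v * ln u)| <= 1 by exact: cos_max.
have i1 : (unif01 R).-integrable setT (EFin \o cst (1 : R)).
  apply: (@integrable_bounded _ _ _ (unif01 R) (cst 1) 1).
    exact: measurable_cst.
  by move=> w; rewrite normr1.
have := RintegralB measurableT i1
  (@integrable_bounded _ _ _ (unif01 R) _ 1 mc cosb).
rewrite Rintegral_cst// [X in _ = 1 * fine X - _](@probability_setT _ _ _
  (unif01 R)).
rewrite mulr1 {1}/Rintegral E/= /F /G ln1 mulr0 cos0 sin0 mulr0 addr0 !mulr1.
lra.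
Qed.

Lemma Rintegral_unif01_expRN_ln (y : R) : 0 <= y ->
  \int[unif01 R]_u expR (- (y * `|ln u|)) = (1 + y)^-1.
Proof.
move=> y0; rewrite /Rintegral -[RHS]/(fine ((1 + y)^-1)%:E).
rewrite -integral_unif01_powR; last by lra.
congr fine; apply: eq_integral_unif01.
- apply/measurable_EFinP; apply: measurable_expRN.
  exact: measurableT_comp (@normr_measurable R setT) (@measurable_ln R).
- apply/measurable_EFinP; exact: measurable_powR.
- move=> u u0 u1; congr EFin; rewrite /powR gt_eqF//; congr expR.
  by rewrite ler0_norm ?ln_le0// mulrN opprK.
Qed.

Lemma measurable_ln_powR (s : R) :
  measurable_fun setT (fun u : R => `|ln u| `^ s).
Proof.
apply: (measurableT_comp (measurable_powR s)).
exact: measurableT_comp (@normr_measurable R setT) (@measurable_ln R).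
Qed.

Lemma integral_unif01_ln_powR_gt0 (s : R) : 0 < s ->
  (0 < \int[unif01 R]_u (`|ln u| `^ s)%:E)%E.
Proof.
move=> s0; pose A : set (measurableTypeR R) := `]0%R, expR (- 1)]%classic.
have mA : measurable A by exact: measurable_itv.
have Ale : (\int[unif01 R]_u (\1_A u)%:E <= \int[unif01 R]_u (`|ln u| `^
  s)%:E)%E.
  apply: ge0_le_integral => //.
  - exact/measurable_EFinP/measurable_indic.
  - apply/measurable_EFinP; exact: measurable_ln_powR.
  - move=> u _; rewrite lee_fin indicE; case: (boolP (u \in A)) => [|_]; last
    first.
      exact: powR_ge0.
    rewrite inE /A/= in_itv/= => /andP[u0 u1].
    have lnu : ln u <= - 1 by rewrite -[leRHS]expRK ler_ln ?posrE// expR_gt0.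
    have n1 : 1 <= `|ln u| by rewrite ler0_norm; lra.
    by rewrite -(powRr0 `|ln u|) ler_powR// ltW.
apply: lt_le_trans Ale; rewrite integral_unif01; last 2 first.
- exact/measurable_EFinP/measurable_indic.
- by move=> u; rewrite lee_fin.
rewrite integral_indic// setIidl; last first.
  move=> u; rewrite /A/= !in_itv/= => /andP[u0 u1]; rewrite (ltW u0)/=.
  by rewrite (le_trans u1)// -[leRHS]expR0 ler_expR oppr_le0.
apply: lt_le_trans (_ : (expR (- 1))%:E <= _)%E; first by rewrite lte_fin
  expR_gt0.
rewrite [leRHS](_ : _ = (expR (- 1))%:E)//.
apply: etrans (lebesgue_measure_itv `]0%R, expR (- 1)]) _.
by rewrite /= lte_fin expR_gt0 oppr0 adde0.
Qed.

Lemma integral_unif01_ln_powR_lty (s : R) : 0 < s ->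
  (\int[unif01 R]_u (`|ln u| `^ s)%:E < +oo)%E.
Proof.
move=> s0; pose n := Num.Def.trunc s.
(* With $t=|\ln u|$ the aim is $t^s\le Ce^{t/2}=Cu^{-1/2}$, integrable on $[0,1]$. It follows from
   $t^s\le1+t^{n+1}$ and $e^{t/2}\ge(t/2)^{n+1}/(n+1)!$. *)
pose C : R := 1 + 2 ^+ n.+1 * (n.+1)`!%:R.
have C0 : 0 < C by rewrite ltr_wpDr.
have m2 : measurable_fun setT (fun u : measurableTypeR R => (u `^ (- 2^-1))%:E).
  by apply/measurable_EFinP; exact: measurable_powR.
have p0 (u : measurableTypeR R) : (0 <= (u `^ (- 2^-1))%:E)%E.
  by rewrite lee_fin powR_ge0.
apply: (@le_lt_trans _ _ (\int[unif01 R]_u (C%:E * (u `^ (- 2^-1))%:E))%E);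
  last first.
  rewrite ge0_integralZl//; last by rewrite lee_fin ltW.
  by rewrite integral_unif01_powR -?EFinM ?ltry//; lra.
have mC : measurable_fun setT (fun u : measurableTypeR R => (C * u `^ (-
  2^-1))%:E).
  apply/measurable_EFinP; apply: measurable_funM; first exact: measurable_cst.
  exact: measurable_powR.
have ml : measurable_fun setT (fun u : measurableTypeR R => (`|ln u| `^ s)%:E).
  by apply/measurable_EFinP; exact: measurable_ln_powR.
rewrite (integral_unif01 ml); last by move=> u; rewrite lee_fin powR_ge0.
rewrite (integral_unif01 mC); last first.
  by move=> u; rewrite lee_fin mulr_ge0 ?powR_ge0// ltW.
apply: ge0_le_integral => //.
- exact: measurable_funTS.
- exact: measurable_funTS.
move=> u; rewrite /= in_itv/= => /andP[u0 u1]; rewrite lee_fin.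
have [->|un0] := eqVneq u 0.
  rewrite ln0// normr0 [leLHS]powR0 ?gt_eqF//.
  by rewrite mulr_ge0 ?powR_ge0// ltW.
have {un0}u_gt0 : 0 < u by rewrite lt_neqAle eq_sym un0.
set t := `|ln u|; have t0 : 0 <= t by exact: normr_ge0.
have -> : u `^ (- 2^-1) = expR (t / 2).
  rewrite /powR gt_eqF//; congr expR.
  by rewrite /t ler0_norm ?ln_le0// mulNr mulrC mulNr.
have e1 : 1 <= expR (t / 2).
  by rewrite -[leLHS]expR0 ler_expR divr_ge0.
apply: (@le_trans _ _ (1 + t ^+ n.+1)).
  have [t1|/ltW t1] := leP t 1.
    apply: (@le_trans _ _ 1); last by rewrite lerDl exprn_ge0.
    have p1 : 1 `^ s = 1 :> R by rewrite powR1.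
    by rewrite -[leRHS]p1; apply: (ge0_ler_powR (ltW s0)); rewrite ?nnegrE.
  apply: (@le_trans _ _ (t ^+ n.+1)); last by rewrite lerDr.
  by rewrite -powR_mulrn// ler_powR// ltW// truncnS_gt.
rewrite /C mulrDl mul1r lerD//.
have t20 : 0 <= t / 2 by rewrite divr_ge0.
have := expR_ge1Dxn n t20; rewrite expr_div_n => h.
have f0 : 0 < (n.+1)`!%:R :> R by rewrite ltr0n fact_gt0.
have q0 : 0 < 2 ^+ n.+1 :> R by rewrite exprn_gt0.
rewrite -ler_pdivrMl ?mulr_gt0// invfM mulrC.
by apply: le_trans h; rewrite mulrA lerDr.
Qed.

End unit_interval_integrals.

(** * Moments of [F] reduced to those of [Phi] *)

Lemma integral_prod_powR d1 d2 (T1 : measurableType d1) (T2 : measurableType d2)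
    (R : realType) (P : probability T1 R) (Q : probability T2 R)
    (X : T1 -> R) (Y : T2 -> R) (s : R) :
  measurable_fun setT X -> (forall w, 0 <= X w) ->
  measurable_fun setT Y -> (forall w, 0 <= Y w) ->
  (\int[prod_prob P Q]_w ((X w.1 * Y w.2) `^ s)%:E =
   \int[P]_w (X w `^ s)%:E * \int[Q]_w (Y w `^ s)%:E)%E.
Proof.
move=> mX X0 mY Y0.
have mXs := measurable_powR_rv mX s; have mYs := measurable_powR_rv mY s.
rewrite ge0_integral_prod_prob; last 2 first.
- apply/measurable_EFinP; apply: (measurableT_comp (measurable_powR s)).
  apply: measurable_funM.
    exact: (measurableT_comp mX measurable_fst).
  exact: (measurableT_comp mY measurable_snd).
- by move=> w; rewrite lee_fin powR_ge0.
under eq_integral => x _.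
  under eq_integral => y _ do rewrite /= powRM// EFinM.
  rewrite ge0_integralZl//; last 3 first.
  - exact/measurable_EFinP.
  - by move=> y _; rewrite lee_fin powR_ge0.
  - by rewrite lee_fin powR_ge0.
  over.
rewrite ge0_integralZr//.
- exact/measurable_EFinP.
- by move=> x _; rewrite lee_fin powR_ge0.
- by apply: integral_ge0 => y _; rewrite lee_fin powR_ge0.
Qed.

(** Used to cancel the moments of $|\ln u|$, which are positive and finite, from an identity between
    possibly infinite products. *)
Lemma mule_lty_iff (R : realType) (k l a b : \bar R) :
  (0 < k < +oo)%E -> (0 < l < +oo)%E -> (0 <= a)%E -> (0 <= b)%E ->
  (k * a = l * b)%E -> (a < +oo)%E <-> (b < +oo)%E.
Proof.
move=> /andP[k0 ky] /andP[l0 ly] a0 b0 E.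
have aux (x y : \bar R) : (0 < x)%E -> (x < +oo)%E -> (0 <= y)%E ->
    ((x * y < +oo)%E <-> (y < +oo)%E).
  move=> x0 xy y0; split => [|yy]; last first.
    by apply: lte_mul_pinfty => //; [exact: ltW|rewrite ge0_fin_numE// ltW].
  apply: contraTT; rewrite -leNgt leye_eq => /eqP ->.
  by rewrite gt0_muley// ltxx.
split=> h.
- by apply/(aux l b l0 ly b0); rewrite -E; apply/(aux k a k0 ky a0).
- by apply/(aux k a k0 ky a0); rewrite E; apply/(aux l b l0 ly b0).
Qed.

Section fourier_moments.
Context (R : realType) (d : nat).
Variables (F : probability (Rn R d) R) (Phi : probability (measurableTypeR R)
  R).
Variable psi : R -> R.
Hypothesis F_fourier : has_fourier_transform F (fun k => psi (enorm k ^+ 2)).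
Hypothesis psi_Phi : forall x, 0 <= x -> psi x = laplace_rv Phi Num.norm x.

(** Taking the frequency along the [j]-th axis reduces the Fourier hypothesis to the one-dimensional
    marginal of $v_j$. *)
Lemma cos_coordinate (j : 'I_d) (x : R) :
  \int[F]_v cos (x * tnth v j) = laplace_rv Phi Num.norm (x ^+ 2).
Proof.
pose k : Rn R d := [tuple if i == j then x else 0 | i < d].
have dk v : dotp k v = x * tnth v j.
  rewrite /dotp (bigD1 j)//= tnth_mktuple eqxx big1 ?addr0// => i ij.
  by rewrite tnth_mktuple (negbTE ij) mul0r.
have kx : enorm k ^+ 2 = x ^+ 2.
  rewrite /enorm dk tnth_mktuple eqxx -expr2 sqr_sqrtr// sqr_ge0.
  by [].
have [+ _] := F_fourier k; rewrite kx psi_Phi ?sqr_ge0// => <-.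
by apply: eq_Rintegral => v _; rewrite dk.
Qed.

(* With [K = |ln u|] exponentially distributed, [E exp(- y K v^2)] and
   [E cos (sqrt y K v)] are both [1 / (1 + y v^2)]. Hence [K V_j^2] under [F]
   and [K^2 W] under [Phi] have the same Laplace transform. *)
Lemma laplace_coordinate (j : 'I_d) (y : R) : 0 <= y ->
  laplace_rv (prod_prob (unif01 R) F)
    (fun w => `|ln w.1| * tnth w.2 j ^+ 2) y =
  laplace_rv (prod_prob (unif01 R) Phi)
    (fun w => `|ln w.1| ^+ 2 * `|w.2|) y.
Proof.
move=> y0.
have mln : measurable_fun setT (fun u : R => `|ln u|).
  exact: measurableT_comp (@normr_measurable R setT) (@measurable_ln R).
have mj2 : measurable_fun setT (fun v : Rn R d => tnth v j ^+ 2).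
  by apply: measurable_funX; exact: measurable_tnth.
rewrite /laplace_rv (@Rintegral_prod_prob2 _ _ _ _ _ _ _ _ 1); last 2 first.
- apply: measurable_expRN; apply: measurable_funM.
    exact: (measurableT_comp mln measurable_fst).
  exact: (measurableT_comp mj2 measurable_snd).
- move=> w; rewrite ger0_norm ?expR_ge0// -expR0 ler_expR oppr_le0.
  by rewrite mulr_ge0// mulr_ge0// ?sqr_ge0.
transitivity (\int[F]_v \int[unif01 R]_u cos (Num.sqrt y * tnth v j * ln u)).
  apply: eq_Rintegral => v _ /=.
  rewrite Rintegral_unif01_cos_ln exprMn (sqr_sqrtr y0).
  rewrite -(Rintegral_unif01_expRN_ln (mulr_ge0 y0 (sqr_ge0 (tnth v j)))).
  by apply: eq_Rintegral => u _; congr (expR (- _)); ring.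
rewrite (@Rintegral_prod_prob _ _ _ _ _ _ _ _ 1); last 2 first.
- apply: measurable_expRN; apply: measurable_funM.
    by apply: measurable_funX; exact: (measurableT_comp mln measurable_fst).
  exact: (measurableT_comp (@normr_measurable R setT) measurable_snd).
- move=> w; rewrite ger0_norm ?expR_ge0// -expR0 ler_expR oppr_le0.
  by rewrite mulr_ge0// mulr_ge0// ?sqr_ge0.
(* The order is exchanged: for fixed $u$ the integral over $v$ is now a Fourier transform along the
   [j]-th axis at frequency $\sqrt y\,\ln u$, which gives $\psi(y\ln^2u)$. *)
rewrite -(@Rintegral_prod_prob2 _ _ _ _ _ (unif01 R) F
  (fun w => cos (Num.sqrt y * tnth w.2 j * ln w.1)) 1); last 2 first.
- have mc : measurable_fun setT (@cos R).
    by apply: continuous_measurable_fun; exact: continuous_cos.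
  apply: (measurableT_comp mc); apply: measurable_funM.
    apply: measurable_funM; first exact: measurable_cst.
    exact: (measurableT_comp (measurable_tnth j) measurable_snd).
  exact: (measurableT_comp (@measurable_ln R) measurable_fst).
- by move=> w; exact: cos_max.
rewrite (@Rintegral_prod_prob _ _ _ _ _ _ _ _ 1); last 2 first.
- have mc : measurable_fun setT (@cos R).
    by apply: continuous_measurable_fun; exact: continuous_cos.
  apply: (measurableT_comp mc); apply: measurable_funM.
    apply: measurable_funM; first exact: measurable_cst.
    exact: (measurableT_comp (measurable_tnth j) measurable_snd).
  exact: (measurableT_comp (@measurable_ln R) measurable_fst).
- by move=> w; exact: cos_max.
apply: eq_Rintegral => u _ /=.
transitivity (\int[F]_v cos (Num.sqrt y * ln u * tnth v j)).
  by apply: eq_Rintegral => v _; congr cos; ring.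
rewrite cos_coordinate exprMn (sqr_sqrtr y0) /laplace_rv.
apply: eq_Rintegral => v _; congr (expR (- _)).
by rewrite -mulrA -normrX (ger0_norm (sqr_ge0 (ln u))).
Qed.

(** Equality of the laws of $KV_j^2$ and $K^2W$ gives $E\,K^s\,E|V_j|^{2s}=E\,K^{2s}\,E\,W^s$ by
    independence. *)
Lemma coordinate_moment_lty (j : 'I_d) (s : R) : 0 < s ->
  (\int[F]_v ((tnth v j ^+ 2) `^ s)%:E < +oo)%E <->
  (\int[Phi]_w (`|w| `^ s)%:E < +oo)%E.
Proof.
move=> s0.
have mln : measurable_fun setT (fun u : measurableTypeR R => `|ln u|).
  exact: measurableT_comp (@normr_measurable R setT) (@measurable_ln R).
have mj2 : measurable_fun setT (fun v : Rn R d => tnth v j ^+ 2).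
  by apply: measurable_funX; exact: measurable_tnth.
have mn : measurable_fun setT (fun w : measurableTypeR R => `|w|).
  exact: normr_measurable.
have sE : (\int[unif01 R]_u ((`|ln u| ^+ 2) `^ s)%:E =
    \int[unif01 R]_u (`|ln u| `^ (2 * s))%:E)%E.
  by apply: eq_integral => u _; rewrite powRrM powR_mulrn.
have nln (u : measurableTypeR R) : 0 <= `|ln u| by exact: normr_ge0.
have nln2 (u : measurableTypeR R) : 0 <= `|ln u| ^+ 2 by exact: sqr_ge0.
have nj2 (v : Rn R d) : 0 <= tnth v j ^+ 2 by exact: sqr_ge0.
have nn (w : measurableTypeR R) : 0 <= `|w| by exact: normr_ge0.
have mln2 : measurable_fun setT (fun u : measurableTypeR R => `|ln u| ^+ 2).
  exact: (measurable_funX 2 mln).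
have s20 : 0 < 2 * s by rewrite mulr_gt0.
have k0 t : 0 < t ->
    (0 < \int[unif01 R]_u (`|ln u| `^ t)%:E < +oo)%E.
  move=> t0; apply/andP; split; first exact: integral_unif01_ln_powR_gt0.
  exact: integral_unif01_ln_powR_lty.
apply: (mule_lty_iff (k0 s s0) (k0 (2 * s) s20)).
- by apply: integral_ge0 => v _; rewrite lee_fin powR_ge0.
- by apply: integral_ge0 => v _; rewrite lee_fin powR_ge0.
rewrite -sE -(integral_prod_powR (unif01 R) F s mln nln mj2 nj2).
rewrite -(integral_prod_powR (unif01 R) Phi s mln2 nln2 mn nn).
refine (eq_moment_laplace_rv _ _ _ _ s0 (laplace_coordinate j)).
- apply: measurable_funM; first exact: (measurableT_comp mln measurable_fst).
  exact: (measurableT_comp mj2 measurable_snd).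
- by move=> w; exact: (mulr_ge0 (nln w.1) (nj2 w.2)).
- apply: measurable_funM; last exact: (measurableT_comp mn measurable_snd).
  exact: (measurableT_comp mln2 measurable_fst).
- by move=> w; exact: (mulr_ge0 (nln2 w.1) (nn w.2)).
Qed.

End fourier_moments.

Section moment2.
Context (R : realType) (d : nat).
Variables (F : probability (Rn R d) R) (Phi : probability (measurableTypeR R)
  R).
Variable psi : R -> R.
Hypothesis F_fourier : has_fourier_transform F (fun k => psi (enorm k ^+ 2)).
Hypothesis psi_Phi : forall x, 0 <= x -> psi x = laplace_rv Phi Num.norm x.

(** The power $|v|^{2s}$ is at least each $v_j^{2s}$, and at most $d^s\max_jv_j^{2s}\le
    d^s\sum_jv_j^{2s}$, because $|v|^2\le d\max_jv_j^2$. *)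
Lemma moment2_lty (s : R) : (1 <= d)%N -> 0 < s ->
  (moment2 F s < +oo)%E <-> (\int[Phi]_w (`|w| `^ s)%:E < +oo)%E.
Proof.
move=> d1 s0; pose j0 : 'I_d := Ordinal d1.
have mj j : measurable_fun setT (fun v : Rn R d => ((tnth v j ^+ 2) `^ s)%:E).
  apply/measurable_EFinP; apply: (measurableT_comp (measurable_powR s)).
  by apply: measurable_funX; exact: measurable_tnth.
have dot0 (v : Rn R d) : 0 <= dotp v v.
  by apply: sumr_ge0 => j _; rewrite -expr2 sqr_ge0.
have mdot : measurable_fun setT (fun v : Rn R d => dotp v v).
  apply: measurable_sum => j; apply: measurable_funM; exact: measurable_tnth.
have m2E : moment2 F s = (\int[F]_v (dotp v v `^ s)%:E)%E.
  apply: eq_integral => v _; rewrite powRrM powR_mulrn ?sqrtr_ge0//.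
  by rewrite /enorm sqr_sqrtr.
have mdots : measurable_fun setT (fun v : Rn R d => (dotp v v `^ s)%:E).
  apply/measurable_EFinP; exact: (measurableT_comp (measurable_powR s) mdot).
have p0 (j : 'I_d) (v : Rn R d) : (0 <= ((tnth v j ^+ 2) `^ s)%:E)%E.
  by rewrite lee_fin powR_ge0.
have jdot (j : 'I_d) (v : Rn R d) : tnth v j ^+ 2 <= dotp v v.
  rewrite /dotp (bigD1 j) //= -expr2 lerDl.
  by apply: sumr_ge0 => i _; rewrite -expr2 sqr_ge0.
rewrite m2E; split => [h|h].
  apply/(coordinate_moment_lty F_fourier psi_Phi j0 s0); apply: le_lt_trans h.
  apply: ge0_le_integral => // v _; rewrite lee_fin.
  by apply: (ge0_ler_powR (ltW s0)); rewrite ?nnegrE ?sqr_ge0.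
pose C := d%:R `^ s : R.
apply: (@le_lt_trans _ _ (\int[F]_v (C%:E * \sum_(j < d) ((tnth v j ^+ 2) `^
  s)%:E))%E).
  apply: ge0_le_integral; [by []| |by []| |].
  - by move=> v _; rewrite lee_fin powR_ge0.
  - by apply: emeasurable_funM; [exact: measurable_cst|exact: emeasurable_sum].
  - move=> v _; rewrite sumEFin -EFinM lee_fin.
    pose i := [arg max_(i > j0) tnth v i ^+ 2]%O.
    have im j : tnth v j ^+ 2 <= tnth v i ^+ 2.
      by rewrite /i; case: arg_maxP => // a _; apply.
    apply: (@le_trans _ _ ((d%:R * tnth v i ^+ 2) `^ s)).
      apply: (ge0_ler_powR (ltW s0) (dot0 v) (mulr_ge0 (ler0n _ _) (sqr_ge0
        _))).
      rewrite /dotp -[X in X%:R](card_ord d) mulr_natl -sumr_const.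
      by apply: ler_sum => j _; rewrite -expr2.
    rewrite (powRM s (ler0n _ d) (sqr_ge0 (tnth v i))).
    apply: (ler_wpM2l (powR_ge0 _ _)).
    rewrite (bigD1 i) // lerDl; apply: sumr_ge0 => k _; exact: powR_ge0.
have mS : measurable_fun setT
    (fun v : Rn R d => \sum_(j < d) ((tnth v j ^+ 2) `^ s)%:E)%E.
  by apply: emeasurable_sum => k; exact: mj.
have S0 (v : Rn R d) : setT v -> (0 <= \sum_(j < d) ((tnth v j ^+ 2) `^
  s)%:E)%E.
  by move=> _; apply: sume_ge0 => k _; exact: p0.
have C0 : (0 <= C%:E)%E by rewrite lee_fin powR_ge0.
rewrite (ge0_integralZl F measurableT mS S0 C0).
rewrite (ge0_integral_sum F measurableT mj (fun k v _ => p0 k v)).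
apply: lte_mul_pinfty; [exact: C0|by []|].
by apply: lte_sum_pinfty => k _; apply/(coordinate_moment_lty F_fourier
  psi_Phi k s0).
Qed.

End moment2.

(** * Inequalities for powers of sums, and zeros of convex functions *)

Section power_sums.
Context (R : realType).

Lemma powR_tangent_le (s a b : R) (k : nat) : 1 <= s -> s <= k%:R ->
  0 <= a -> a <= b -> b `^ s <= a `^ s + k%:R * (b `^ (s - 1) * (b - a)).
Proof.
move=> s1 sk a0 ab; have s0 : 0 < s by lra.
have [b0|b0] := eqVneq b 0.
  have -> : a = 0 by apply/eqP; rewrite eq_le a0 -b0 ab.
  by rewrite b0 subr0 !mulr0 addr0.
have {}b0 : 0 < b by rewrite lt_neqAle eq_sym b0 (le_trans a0).
pose t := a / b.
have t0 : 0 <= t by rewrite divr_ge0// ltW.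
have t1 : t <= 1 by rewrite ler_pdivrMr// mul1r.
have aE : a = t * b by rewrite /t divfK// gt_eqF.
have h1 : t ^+ k <= t `^ s.
  have [->|tn0] := eqVneq t 0.
    rewrite powR0 ?gt_eqF//; case: k sk => [|k _]; last by rewrite expr0n.
    by move=> /(lt_le_trans s0); rewrite ltxx.
  have tgt0 : 0 < t by rewrite lt_neqAle eq_sym tn0.
  by rewrite -powR_mulrn// ger_powR// tgt0.
have h2 : 1 - k%:R * (1 - t) <= t ^+ k.
  have /(@bernoulli_onem _ _ k) : 0 <= 1 - t <= 1 by lra.
  by rewrite subKr.
have bs : b `^ s = b `^ (s - 1) * b by rewrite mulrC mulr_powRB1// ltW.
rewrite [in X in _ <= X + _]aE powRM// ?(ltW b0)//.
apply: (@le_trans _ _ ((1 - k%:R * (1 - t)) * b `^ s + k%:R * (b `^ (s - 1) *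
  (b - a)))).
  by rewrite le_eqVlt; apply/orP; left; apply/eqP; rewrite bs [in RHS]aE; ring.
by rewrite lerD2r ler_wpM2r ?powR_ge0// (le_trans h2).
Qed.

Variables (n : nat) (x : 'I_n.+1 -> R).
Hypothesis x0 : forall i, 0 <= x i.

Let S := \sum_i x i.

Let S0 : 0 <= S. Proof. exact: sumr_ge0. Qed.

Let xS i : x i <= S.
Proof. by rewrite /S (bigD1 i)//= lerDl sumr_ge0. Qed.

(** Write $S^s=\sum_ix_iS^{s-1}$ and use $x_i\le S$. The strict version below gains at index [i],
    where a second positive term makes $x_i<S$. *)
Lemma sum_powR_le (s : R) : 1 <= s -> \sum_i x i `^ s <= S `^ s.
Proof.
move=> s1; have s0 : 0 < s by lra.
rewrite -(mulr_powRB1 S0 s0) [in leRHS]/S mulr_suml.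
apply: ler_sum => i _; rewrite -(mulr_powRB1 (x0 i) s0) ler_wpM2l//.
by apply: ge0_ler_powR; rewrite ?nnegrE//; lra.
Qed.

Lemma sum_powR_lt (s : R) (i j : 'I_n.+1) : 1 < s -> i != j ->
  0 < x i -> 0 < x j -> \sum_i x i `^ s < S `^ s.
Proof.
move=> s1 ij xi xj; have s0 : 0 < s by lra.
rewrite -(mulr_powRB1 S0 s0) [in ltRHS]/S mulr_suml.
rewrite (bigD1 i)//= [ltRHS](bigD1 i)//=; apply: ltr_leD.
  rewrite -(mulr_powRB1 (x0 i) s0) ltr_pM2l//.
  apply: gt0_ltr_powR; rewrite ?nnegrE//; first by lra.
  rewrite /S (bigD1 i)//= (bigD1 j) 1?eq_sym//= ltrDl.
  by rewrite ltr_wpDr// sumr_ge0.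
apply: ler_sum => k _; rewrite -(mulr_powRB1 (x0 k) s0) ler_wpM2l//.
by apply: ge0_ler_powR; rewrite ?nnegrE//; lra.
Qed.

(* Tangent inequality at the largest [x l]: the increment from [x l] to the
   sum only involves the other terms. *)
Lemma powR_sum_le (s : R) (k : nat) : 1 <= s -> s <= k%:R ->
  S `^ s <= \sum_i x i `^ s + k%:R * n.+1%:R `^ (s - 1) *
    \sum_i \sum_(j | j != i) x i `^ (s - 1) * x j.
Proof.
move=> s1 sk; have s10 : 0 <= s - 1 by lra.
pose l := [arg max_(i > ord0) x i]%O.
have xl j : x j <= x l by rewrite /l; case: arg_maxP => // a _; apply.
have SE : S - x l = \sum_(j | j != l) x j.
  by rewrite /S (bigD1 l)//= [X in X - _]addrC addrK.
have Sl : S `^ (s - 1) <= n.+1%:R `^ (s - 1) * x l `^ (s - 1).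
  rewrite -powRM//; apply: ge0_ler_powR; rewrite ?nnegrE ?mulr_ge0//.
  rewrite /S -[X in X%:R](card_ord n.+1) mulr_natl -sumr_const.
  exact: ler_sum.
apply: (le_trans (powR_tangent_le s1 sk (x0 l) (xS l))).
apply: lerD.
  by rewrite (bigD1 l)//= lerDl sumr_ge0// => i _; rewrite powR_ge0.
rewrite -mulrA ler_wpM2l//.
apply: (@le_trans _ _ (n.+1%:R `^ (s - 1) * (x l `^ (s - 1) * (S - x l)))).
  by rewrite [leRHS]mulrA ler_wpM2r// subr_ge0.
rewrite ler_wpM2l ?powR_ge0// SE mulr_sumr [leRHS](bigD1 l)//= lerDl.
apply: sumr_ge0 => i _; apply: sumr_ge0 => j _.
by rewrite mulr_ge0// powR_ge0.
Qed.

End power_sums.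

(** An intermediate value theorem that takes the needed continuity from convexity: [c] is the
    supremum of the points of $[r,s]$ where $g<0$, and each sign of $g(c)$ is refuted by a chord. *)
Lemma convex_zero_after (R : realType) (g : R -> R) (r s : R) :
  (forall x y t : R, 0 < x -> 0 < y -> 0 <= t -> t <= 1 ->
    g ((1 - t) * x + t * y) <= (1 - t) * g x + t * g y) ->
  0 < r -> r < s -> g r < 0 -> 0 < g s ->
  exists2 c, r <= c & g c = 0.
Proof.
move=> gconv r0 rs gr gs.
pose E : set R := [set x | r <= x <= s /\ g x < 0].
have Er : E r by rewrite /E/= lexx ltW.
have Es : ubound E s by move=> x [/andP[]].
have supE : has_sup E by split; [exists r|exists s].
pose c := sup E.
have rc : r <= c by apply: ub_le_sup => //; exists s.
have cs : c <= s by apply: ge_sup => //; exists r.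
have c0 : 0 < c by exact: lt_le_trans rc.
have s0 : 0 < s by exact: lt_trans rs.
exists c => //; apply/eqP; rewrite eq_le; apply/andP; split; rewrite leNgt;
  apply/negP.
(* If $g(c)>0$, take $x\le c$ within [e] of [c] with $g(x)<0$. On the chord from $x$ to $s+1$, of
   length at least 1, the point [c] has parameter $t<e$, whence $g(c)\le tM\le g(c)/2$. *)
- move=> gc; pose M := `|g (s + 1)| + 1.
  have M0 : 0 < M by rewrite ltr_wpDl.
  pose e := g c / (2 * M).
  have e0 : 0 < e by rewrite divr_gt0// mulr_gt0.
  have [x [/andP[rx xs] gx]] := sup_adherent e0 supE.
  rewrite -/c => cex.
  have xc : x <= c.
    by apply: ub_le_sup; [exists s|rewrite /E/= rx xs].
  have x0 : 0 < x by exact: lt_le_trans rx.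
  pose t := (c - x) / (s + 1 - x).
  have d1 : 1 <= s + 1 - x by lra.
  have t0 : 0 <= t by rewrite divr_ge0; lra.
  have te : t < e.
    rewrite ltr_pdivrMr; last by lra.
    apply: lt_le_trans (ler_peMr (ltW e0) d1); lra.
  have t1 : t <= 1 by rewrite ler_pdivrMr ?mul1r; lra.
  have s1 : 0 < s + 1 by lra.
  have := gconv x (s + 1) t x0 s1 t0 t1.
  have -> : (1 - t) * x + t * (s + 1) = c.
    rewrite [LHS](_ : _ = x + t * (s + 1 - x)); last by ring.
    rewrite /t divfK; last by rewrite gt_eqF//; lra.
    by rewrite addrC subrK.
  have h1 : (1 - t) * g x <= 0 by rewrite mulr_ge0_le0//; lra.
  have h2 : t * g (s + 1) <= t * M.
    by rewrite ler_wpM2l// (le_trans (ler_norm _))// lerDl.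
  have h3 : t * M <= e * M by rewrite ler_pM2r// ltW.
  have h4 : e * M = g c / 2 by rewrite /e; field; rewrite gt_eqF.
  lra.
(* If $g(c)<0$, this parameter makes the chord from [c] to [s] take the value $g(c)/2<0$, so $g$ is
   still negative at a point to the right of [c]. *)
- move=> gc; have gcs : 0 < g s - g c by lra.
  pose t := - g c / (2 * (g s - g c)).
  have t0 : 0 < t by rewrite divr_gt0//; lra.
  have t1 : t <= 1 by rewrite ler_pdivrMr ?mul1r; lra.
  have := gconv c s t c0 s0 (ltW t0) t1.
  set x := (1 - t) * c + t * s => gx.
  have tE : t * (g s - g c) = - g c / 2 by rewrite /t; field; rewrite gt_eqF.
  have cs' : c < s.
    by rewrite lt_neqAle cs andbT; apply/eqP => ce; move: gc gs; rewrite ce;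
      lra.
  have tcs : 0 < t * (s - c) by rewrite mulr_gt0//; lra.
  have ts : t * (s - c) <= 1 * (s - c) by rewrite ler_wpM2r//; lra.
  have : x <= c.
    apply: ub_le_sup; first by exists s.
    by split; [apply/andP; rewrite /x; split|]; lra.
  by rewrite /x; lra.
Qed.

(** * Symmetric measures on bounded boxes, and the function [lambda] *)

Section measures_on_Rn_lemmas.
Context (R : realType).

Lemma measurable_box n (C : R) :
  measurable ([set a | forall i, 0 < tnth a i <= C] : set (Rn R n)).
Proof.
rewrite (_ : [set a | _] = \bigcap_(i in [set: 'I_n])
    ((fun a : Rn R n => tnth a i) @^-1` `]0, C]%classic)).
  apply: fin_bigcap_measurable => // i _.
  by rewrite -[X in measurable X]setTI; exact: measurable_tnth.
apply/seteqP; split => [a Oa i _|a Oa i] /=; first by rewrite in_itv/= Oa.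
by have := Oa i I; rewrite /= in_itv/=.
Qed.

Lemma measurable_coordinate n (g : R -> R) (i : 'I_n) :
  measurable_fun setT g -> measurable_fun setT (fun a : Rn R n => g (tnth a i)).
Proof. by move=> mg; exact: (measurableT_comp mg (measurable_tnth i)). Qed.

Lemma measurable_norm_powR (s : R) :
  measurable_fun setT (fun a : R => `|a| `^ s).
Proof.
exact: (measurableT_comp (measurable_powR s) (@normr_measurable R setT)).
Qed.

Lemma symmetric_integral n (A : probability (Rn R n) R) (g : R -> R) (i j :
  'I_n) :
  symmetric_measure A -> measurable_fun setT g -> (forall v, 0 <= g v) ->
  (\int[A]_a (g (tnth a i))%:E = \int[A]_a (g (tnth a j))%:E)%E.
Proof.
move=> symA mg g0.
pose phi (a : Rn R n) : Rn R n := [tuple tnth a (tperm i j k) | k < n].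
have mphi : measurable_fun setT phi.
  apply/measurable_fun_tnthP => k; rewrite /comp/=.
  apply: (eq_measurable_fun (fun a : Rn R n => tnth a (tperm i j k))).
    by move=> a _; rewrite tnth_mktuple.
  exact: measurable_tnth.
have mG := measurable_coordinate j mg.
transitivity (\int[pushforward A phi]_a (g (tnth a j))%:E)%E.
  rewrite ge0_integral_pushforward//; last 2 first.
  - exact/measurable_EFinP.
  - by move=> a _; rewrite lee_fin.
  by apply: eq_integral => a _ /=; rewrite tnth_mktuple tpermR.
by apply: eq_measure_integral => B mB _; exact: symA.
Qed.

End measures_on_Rn_lemmas.

Section lambda_properties.
Context (R : realType) (N : nat).
Variables (alpha : nat -> {nonneg R}) (A : forall n, probability (Rn R n) R).
Variable C : nat -> R.
Hypothesis A_box : forall n, (n < N)%N ->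
  A n.+1 [set a | forall i, 0 < tnth a i <= C n] = 1%E.
Hypothesis A_sym : forall n, (n < N)%N -> symmetric_measure (A n.+1).

Lemma box_orthant n : (n < N)%N -> A n.+1 (@orthant R n.+1) = 1%E.
Proof.
move=> nN; apply/eqP; rewrite eq_le probability_le1/=; last exact:
  measurable_orthant.
rewrite -(A_box nN); apply: le_measure; rewrite ?inE.
- exact: measurable_box.
- exact: measurable_orthant.
- by move=> a Ca i; have /andP[/ltW] := Ca i.
Qed.

Lemma box_integral_le n (f g : Rn R n.+1 -> \bar R) : (n < N)%N ->
  measurable_fun setT f -> measurable_fun setT g ->
  (forall a, (0 <= f a)%E) ->
  (forall a, (forall i, 0 < tnth a i <= C n) -> (f a <= g a)%E) ->
  (\int[A n.+1]_a f a <= \int[A n.+1]_a g a)%E.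
Proof.
move=> nN mf mg f0 fg.
have mB := @measurable_box R n.+1 (C n).
pose B : set (Rn R n.+1) := [set a | forall i, 0 < tnth a i <= C n].
have E (h : Rn R n.+1 -> \bar R) : measurable_fun setT h ->
    (\int[A n.+1]_(a in B) h a = \int[A n.+1]_a h a)%E.
  move=> mh; apply: (prob_eq_integral mB (A_box nN) _ mh) => //.
  exact: measurable_funTS mh.
rewrite -(E f mf) -(E g mg); apply: ge0_le_integral => //.
- exact: measurable_funTS mf.
- exact: measurable_funTS mg.
Qed.

Definition coordinate_moment n (s : R) : \bar R :=
  (\int[A n.+1]_a (`|tnth a ord0| `^ s)%:E)%E.

Lemma coordinate_momentE n (k : 'I_n.+1) (s : R) : (n < N)%N ->
  (\int[A n.+1]_a (`|tnth a k| `^ s)%:E = coordinate_moment n s)%E.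
Proof.
move=> nN; apply: (@symmetric_integral _ _ _ (fun v => `|v| `^ s)).
- exact: A_sym.
- exact: measurable_norm_powR.
- by move=> v; exact: powR_ge0.
Qed.

Lemma coordinate_moment_ge0 n s : (0 <= coordinate_moment n s)%E.
Proof. by apply: integral_ge0 => a _; rewrite lee_fin powR_ge0. Qed.

Lemma coordinate_moment_lty_box n s : (n < N)%N -> 0 <= s ->
  (coordinate_moment n s < +oo)%E.
Proof.
move=> nN s0.
apply: (@le_lt_trans _ _ (\int[A n.+1]_a (cst (`|C n| `^ s)%:E a))%E).
  apply: box_integral_le => //.
  - apply/measurable_EFinP; apply: (@measurable_coordinate _ _ (fun v => `|v|
    `^ s)).
    exact: measurable_norm_powR.
  - move=> a Ca; rewrite lee_fin; have /andP[a0 aC] := Ca ord0.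
    apply: ge0_ler_powR; rewrite ?nnegrE// (gtr0_norm a0).
    exact: le_trans aC (ler_norm _).
rewrite integral_cst// [X in (_ * X)%E](@probability_setT _ _ _ (A n.+1)).
by rewrite mule1 ltry.
Qed.

Lemma coordinate_moment_gt0 n s : (n < N)%N -> (0 < coordinate_moment n s)%E.
Proof.
move=> nN; rewrite lt_neqAle coordinate_moment_ge0 andbT eq_sym; apply/eqP => E.
have mf : measurable_fun setT (fun a : Rn R n.+1 => (`|tnth a ord0| `^ s)%:E).
  apply/measurable_EFinP; apply: (@measurable_coordinate _ _ (fun v => `|v| `^
    s)).
  exact: measurable_norm_powR.
have : (\int[A n.+1]_a `|(`|tnth a ord0| `^ s)%:E|)%E = 0%E.
  by rewrite -E; apply: eq_integral => a _; rewrite gee0_abs// lee_fin powR_ge0.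
move=> /(ae_eq_integral_abs (A n.+1) measurableT mf) [Z [mZ Z0 subZ]].
have : (A n.+1 [set a | forall i, (0 < tnth a i <= C n)%R] <= A n.+1 Z)%E.
  apply: le_measure; rewrite ?inE//; first exact: measurable_box.
  move=> a Ca; apply: subZ => /= h; have /andP[a0 _] := Ca ord0.
  have [/eqP] := h I; apply/negP; rewrite gt_eqF// powR_gt0//.
  by rewrite normr_gt0 gt_eqF.
by rewrite (A_box nN) Z0 lee_fin ler10.
Qed.

Let D : set (measurableTypeR R) := `[0%R, +oo[%classic.

Let mD : measurable D. Proof. exact: measurable_itv. Qed.

Lemma integral_Kmeasure (s : R) :
  (\int[Kmeasure N alpha A]_(a in D) (a `^ s)%:E =
   \sum_(n < N) (n.+1%:R * (alpha n.+1)%:num)%:E * coordinate_moment n s)%E.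
Proof.
have mp : measurable_fun D (fun a : measurableTypeR R => (a `^ s)%:E).
  by apply: measurable_funTS; apply/measurable_EFinP; exact: measurable_powR.
have p0 (a : measurableTypeR R) : D a -> (0 <= (a `^ s)%:E)%E.
  by move=> _; rewrite lee_fin powR_ge0.
rewrite /Kmeasure ge0_integral_measure_sum//; apply: eq_bigr => n _.
rewrite ge0_integral_mscale//; congr mule.
have mn : measurable_fun setT (fun a : measurableTypeR R => (`|a| `^ s)%:E).
  by apply/measurable_EFinP; exact: measurable_norm_powR.
rewrite (prob_eq_integral mD _ mp mn); last 2 first.
- have mT : measurable (setT `&` (fun a : Rn R n.+1 => tnth a ord0) @^-1` D).
    exact: (measurable_tnth ord0 measurableT mD).
  rewrite setTI in mT; rewrite /distribution/pushforward.
  apply/eqP; rewrite eq_le probability_le1//=.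
  rewrite -(box_orthant (ltn_ord n)); apply: le_measure; rewrite ?inE.
  + exact: measurable_orthant.
  + exact: mT.
  + by move=> a Oa; rewrite /D/= in_itv/= andbT; exact: Oa.
- by move=> a; rewrite inE /D/= in_itv/= andbT => a0; rewrite ger0_norm.
by rewrite ge0_integral_distribution.
Qed.

Lemma EFin_lambda (s : R) : 0 <= s ->
  ((lambda N alpha A s)%:E = \int[Kmeasure N alpha A]_(a in D) (a `^ s)%:E)%E.
Proof.
move=> s0; rewrite fineK// integral_Kmeasure.
have g0 n : (0 <= (n.+1%:R * (alpha n.+1)%:num)%:E * coordinate_moment n s)%E.
  by rewrite mule_ge0// ?coordinate_moment_ge0// lee_fin mulr_ge0.
rewrite ge0_fin_numE; last by apply: sume_ge0 => n _; exact: g0.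
apply: lte_sum_pinfty => n _; apply: lte_mul_pinfty => //.
exact: coordinate_moment_lty_box.
Qed.

(** Symmetry spreads the weight $n$ of the first marginal over all $n$ coordinates; this is the form
    in which the diagonal terms of a moment of the sum produce [lambda]. *)
Lemma lambdaE (s : R) : 0 <= s ->
  ((lambda N alpha A s)%:E = \sum_(n < N) ((alpha n.+1)%:num)%:E *
    \sum_(k < n.+1) \int[A n.+1]_a (`|tnth a k| `^ s)%:E)%E.
Proof.
move=> s0; rewrite EFin_lambda// integral_Kmeasure; apply: eq_bigr => n _.
under [in RHS]eq_bigr => k _ do rewrite coordinate_momentE//.
have cE : coordinate_moment n s = (fine (coordinate_moment n s))%:E.
  by rewrite fineK// ge0_fin_numE ?coordinate_moment_ge0//
    coordinate_moment_lty_box.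
rewrite cE sumEFin sumr_const card_ord -!EFinM -mulr_natl; congr EFin; ring.
Qed.

Lemma lambda_gt0 (s : R) : (0 < N)%N -> 0 < (alpha N)%:num -> 0 <= s ->
  0 < lambda N alpha A s.
Proof.
move=> N0 aN s0; rewrite -lte_fin EFin_lambda// integral_Kmeasure.
have N1 : (N.-1 < N)%N by rewrite prednK.
have g0 n : (0 <= (n.+1%:R * (alpha n.+1)%:num)%:E * coordinate_moment n s)%E.
  by rewrite mule_ge0// ?coordinate_moment_ge0// lee_fin mulr_ge0.
rewrite (bigD1 (Ordinal N1))//=; apply: (@lt_le_trans _ _
    ((N.-1.+1%:R * (alpha N.-1.+1)%:num)%:E * coordinate_moment N.-1 s)%E).
  apply: mule_gt0; last exact: coordinate_moment_gt0.
  by rewrite lte_fin mulr_gt0// prednK.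
by rewrite leeDl// sume_ge0.
Qed.

(** Pointwise in $a$: with $b=\ln a$ and [c] the intermediate exponent, the tangent inequality
    $e^{ub}\ge e^{cb}(1+ub-cb)$ is averaged over $u=x,y$, and the linear terms cancel. *)
Lemma lambda_convex (x y t : R) : 0 < x -> 0 < y -> 0 <= t -> t <= 1 ->
  lambda N alpha A ((1 - t) * x + t * y) <=
  (1 - t) * lambda N alpha A x + t * lambda N alpha A y.
Proof.
move=> x0 y0 t0 t1; have t10 : 0 <= 1 - t by rewrite subr_ge0.
have xy0 : 0 < (1 - t) * x + t * y.
  have [->|tn] := eqVneq t 0; first by rewrite subr0 mul1r mul0r addr0.
  by rewrite ltr_wpDl ?mulr_ge0 ?(ltW x0)// mulr_gt0// lt_neqAle eq_sym tn.
rewrite -lee_fin EFinD 2!EFinM !EFin_lambda ?(ltW x0) ?(ltW y0) ?(ltW xy0)//.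
have mp s : measurable_fun D (fun a : measurableTypeR R => (a `^ s)%:E).
  by apply: measurable_funTS; apply/measurable_EFinP; exact: measurable_powR.
have p0 s (a : measurableTypeR R) : D a -> (0 <= (a `^ s)%:E)%E.
  by move=> _; rewrite lee_fin powR_ge0.
rewrite -!ge0_integralZl//; try exact: p0.
rewrite -ge0_integralD//; last 4 first.
- by move=> a _; rewrite mule_ge0// lee_fin ?powR_ge0.
- by apply: emeasurable_funM => //; exact: measurable_cst.
- by move=> a _; rewrite mule_ge0// lee_fin ?powR_ge0.
- by apply: emeasurable_funM => //; exact: measurable_cst.
apply: ge0_le_integral => //.
- by move=> a Da; exact: p0.
- apply: emeasurable_funD; apply: emeasurable_funM => //; exact: measurable_cst.
move=> a; rewrite /D/= in_itv/= andbT => a0; rewrite -!EFinM -EFinD lee_fin.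
(* At $a=0$ the logarithm is a default value; there the left-hand side is 0 because the intermediate
   exponent is positive. *)
have [->|an0] := eqVneq a 0.
  by rewrite powR0 ?gt_eqF// addr_ge0// mulr_ge0// powR_ge0.
rewrite /powR (negbTE an0).
set b := ln a; set c := (1 - t) * x + t * y.
have key u : expR (c * b) * (1 + (u * b - c * b)) <= expR (u * b).
  have -> : expR (u * b) = expR (c * b) * expR (u * b - c * b).
    by rewrite -expRD; congr expR; ring.
  by rewrite ler_wpM2l ?expR_ge0// expR_ge1Dx.
apply: le_trans (lerD (ler_wpM2l t10 (key x)) (ler_wpM2l t0 (key y))).
by rewrite le_eqVlt; apply/orP; left; apply/eqP; rewrite /c; ring.
Qed.

End lambda_properties.

(** * The effect of one step on moments *)

Section step_moments.
Context (R : realType) (N : nat).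
Variables (alpha : nat -> {nonneg R}) (A : forall n, probability (Rn R n) R).
Hypothesis alpha_sum : \sum_(n < N) (alpha n.+1)%:num = 1.
Variable C : nat -> R.
Hypothesis A_box : forall n, (n < N)%N ->
  A n.+1 [set a | forall i, 0 < tnth a i <= C n] = 1%E.
Hypothesis A_sym : forall n, (n < N)%N -> symmetric_measure (A n.+1).
Variable m : R.
Variable P : probability (measurableTypeR R) R.

Definition abs_moment (Q : probability (measurableTypeR R) R) (s : R) : \bar R
  :=
  (\int[Q]_v (`|v| `^ s)%:E)%E.

Lemma abs_moment_ge0 Q s : (0 <= abs_moment Q s)%E.
Proof. by apply: integral_ge0 => v _; rewrite lee_fin powR_ge0. Qed.

Definition term n (w : Rn R n * Rn R n) (k : 'I_n) : R :=
  `|tnth w.1 k| * `|tnth w.2 k|.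

Lemma term_ge0 n w k : 0 <= @term n w k.
Proof. by rewrite mulr_ge0. Qed.

Lemma measurable_abs_coordinate n (k : 'I_n) :
  measurable_fun setT (fun a : Rn R n => `|tnth a k|).
Proof.
exact: (measurable_coordinate k (@normr_measurable R setT)).
Qed.

Lemma measurable_term n (k : 'I_n) : measurable_fun setT (fun w => @term n w k).
Proof.
apply: measurable_funM.
  exact: (measurableT_comp (measurable_abs_coordinate k) measurable_fst).
exact: (measurableT_comp (measurable_abs_coordinate k) measurable_snd).
Qed.

Definition sum_moment n (s : R) : \bar R :=
  (\int[prod_prob (A n.+1) (power_prob P n.+1)]_w
    ((\sum_k term w k) `^ s)%:E)%E.

Lemma measurable_sum_moment n s :
  measurable_fun setT (fun w => ((\sum_k @term n w k) `^ s)%:E).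
Proof.
apply/measurable_EFinP; apply: (measurableT_comp (measurable_powR s)).
by apply: measurable_sum => k; exact: measurable_term.
Qed.

(** The prefactor is $E\,U^{ms}$, finite because $ms>-1$; it factors out since $U$ is independent of
    the sum. *)
Lemma moment_step (s : R) : - 1 < m * s ->
  abs_moment (step A alpha_sum m P) s =
  (((1 + m * s)^-1)%:E * \sum_(n < N) ((alpha n.+1)%:num)%:E * sum_moment n
    s)%E.
Proof.
move=> ms; rewrite /abs_moment integral_step; last 2 first.
- by apply/measurable_EFinP; exact: measurable_norm_powR.
- by move=> v; rewrite lee_fin powR_ge0.
rewrite ge0_sume_distrr; last first.
  move=> n _; rewrite mule_ge0//; apply: integral_ge0 => w _.
  by rewrite lee_fin powR_ge0.
apply: eq_bigr => n _; rewrite muleCA; congr mule.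
rewrite /sum_moment ge0_integral_prod_prob; last 2 first.
- exact: measurable_sum_moment.
- by move=> w; rewrite lee_fin powR_ge0.
set J := (X in _ = (_ * X)%E).
have J0 : (0 <= J)%E.
  by apply: integral_ge0 => a _; apply: integral_ge0 => x _; rewrite lee_fin
    powR_ge0.
transitivity (\int[unif01 R]_u ((u `^ (m * s))%:E * J))%E; last first.
  rewrite ge0_integralZr//.
  - by rewrite integral_unif01_powR.
  - by apply/measurable_EFinP; exact: measurable_powR.
  - by move=> u _; rewrite lee_fin powR_ge0.
apply: eq_integral => u _.
have mS (a : Rn R n.+1) : measurable_fun setT
    (fun x => ((\sum_k term (a, x) k) `^ s)%:E).
  exact: (measurableT_comp (@measurable_sum_moment n.+1 s) (measurable_pair1
    a)).
transitivity (\int[A n.+1]_a ((u `^ (m * s))%:E *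
    \int[power_prob P n.+1]_x ((\sum_k term (a, x) k) `^ s)%:E))%E; last first.
  rewrite ge0_integralZl//.
  - apply: (measurable_fun_fubini_tonelli_F (m2 := power_prob P n.+1)
      (fun w => ((\sum_k @term n.+1 w k) `^ s)%:E)).
      exact: measurable_sum_moment.
    by move=> w; rewrite lee_fin powR_ge0.
  - by move=> a _; apply: integral_ge0 => x _; rewrite lee_fin powR_ge0.
  - by rewrite lee_fin powR_ge0.
apply: eq_integral => a _; rewrite -ge0_integralZl//; last 2 first.
- by move=> x _; rewrite lee_fin powR_ge0.
- by rewrite lee_fin powR_ge0.
apply: eq_integral => x _; rewrite -EFinM.
have S0 : 0 <= \sum_k term (a, x) k by apply: sumr_ge0 => k _; exact: term_ge0.
by rewrite ger0_norm ?mulr_ge0 ?powR_ge0// powRM ?powR_ge0// -powRrM.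
Qed.

Definition coefficient_moment n (s : R) : \bar R :=
  (\sum_(k < n.+1) \int[A n.+1]_a (`|tnth a k| `^ s)%:E)%E.

Lemma integral_sum_terms n (s : R) :
  (\int[prod_prob (A n.+1) (power_prob P n.+1)]_w
    (\sum_k term w k `^ s)%:E = coefficient_moment n s * abs_moment P s)%E.
Proof.
under eq_integral => w _ do rewrite -sumEFin.
rewrite ge0_integral_sum//; last 2 first.
- move=> k; apply/measurable_EFinP; apply: (measurableT_comp (measurable_powR
  s)).
  exact: measurable_term.
- by move=> k w _; rewrite lee_fin powR_ge0.
rewrite ge0_sume_distrl; last first.
  by move=> k _; apply: integral_ge0 => a _; rewrite lee_fin powR_ge0.
apply: eq_bigr => k _.
rewrite (integral_prod_powR (A n.+1) (power_prob P n.+1) s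
  (measurable_abs_coordinate k) _ (measurable_abs_coordinate k))//.
congr mule; exact: (@integral_power_prob1 _ _ _ P n.+1 k (fun v => `|v| `^ s)
  (measurable_norm_powR s) (fun v => powR_ge0 _ _)).
Qed.

Lemma coefficient_moment_ge0 n s : (0 <= coefficient_moment n s)%E.
Proof.
apply: sume_ge0 => k _; apply: integral_ge0 => a _.
by rewrite lee_fin powR_ge0.
Qed.

Lemma sum_moment1 n : sum_moment n 1 =
  (coefficient_moment n 1 * abs_moment P 1)%E.
Proof.
rewrite -integral_sum_terms; apply: eq_integral => w _; congr EFin.
rewrite powRr1; last by apply: sumr_ge0 => k _; exact: term_ge0.
by apply: eq_bigr => k _; rewrite powRr1// term_ge0.
Qed.

(** The two copies are distinct, hence independent, and the coefficients are bounded by [C n] almost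
    surely. *)
Let cross n (s : R) (i j : 'I_n.+1) : 1 <= s -> (n < N)%N -> i != j ->
  (\int[prod_prob (A n.+1) (power_prob P n.+1)]_w
    (term w i `^ (s - 1) * term w j)%:E <=
   (`|C n| `^ (s - 1) * `|C n|)%:E * (abs_moment P (s - 1) * abs_moment P 1))%E.
Proof.
move=> s1 nN ij; have s10 : 0 <= s - 1 by rewrite subr_ge0.
pose f (a : Rn R n.+1) := `|tnth a i| `^ (s - 1) * `|tnth a j|.
have mf : measurable_fun setT f.
  apply: measurable_funM; last exact: measurable_abs_coordinate.
  exact: (measurable_coordinate i (measurable_norm_powR (s - 1))).
have f0 a : 0 <= f a by rewrite mulr_ge0// powR_ge0.
have fE (w : Rn R n.+1 * Rn R n.+1) :
    term w i `^ (s - 1) * term w j = (f w.1 * f w.2) `^ 1.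
  by rewrite powRr1 ?mulr_ge0// /f /term powRM//; ring.
under eq_integral => w _ do rewrite fE.
rewrite integral_prod_powR//.
have f1 (Q : probability (Rn R n.+1) R) :
    (\int[Q]_a (f a `^ 1)%:E = \int[Q]_a (f a)%:E)%E.
  by apply: eq_integral => a _; rewrite powRr1.
rewrite !f1 [X in (_ * X <= _)%E](_ : _ = abs_moment P (s - 1) * abs_moment P
  1)%E; last first.
  rewrite (@integral_power_prob2 _ _ _ P n.+1 i j (fun v => `|v| `^ (s - 1))
    (fun v => `|v|) ij (measurable_norm_powR (s - 1)) (fun v => powR_ge0 _ _)
    (@normr_measurable R setT) (fun v => normr_ge0 v)).
  by congr mule; apply: eq_integral => v _; rewrite powRr1.
apply: lee_wpmul2r; first by rewrite mule_ge0// abs_moment_ge0.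
apply: (@le_trans _ _ (\int[A n.+1]_a (cst (`|C n| `^ (s - 1) * `|C n|)%:E
  a))%E).
  apply: (box_integral_le A_box) => //.
  - exact/measurable_EFinP.
  - move=> a Ca; rewrite lee_fin; apply: ler_pM; rewrite ?powR_ge0//.
      have /andP[a0 aC] := Ca i.
      apply: ge0_ler_powR; rewrite ?nnegrE// (gtr0_norm a0).
      exact: le_trans aC (ler_norm _).
    have /andP[a0 aC] := Ca j; rewrite (gtr0_norm a0).
    exact: le_trans aC (ler_norm _).
rewrite integral_cst// [X in (_ * X)%E](@probability_setT _ _ _ (A n.+1)).
by rewrite mule1.
Qed.

(** The constant of [powR_sum_le] times the number of ordered pairs of distinct indices, each
    weighted by the bound on the coefficients from [cross]. *)
Definition cross_bound (k : nat) (s : R) n : R :=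
  k%:R * n.+1%:R `^ (s - 1) *
  \sum_(i < n.+1) \sum_(j < n.+1 | j != i) (`|C n| `^ (s - 1) * `|C n|).

Lemma cross_bound_ge0 k s n : 0 <= cross_bound k s n.
Proof.
rewrite !mulr_ge0 ?powR_ge0//; apply: sumr_ge0 => i _; apply: sumr_ge0 => j _.
by rewrite mulr_ge0// powR_ge0.
Qed.

Lemma sum_moment_le n (s : R) (k : nat) : 1 <= s -> s <= k%:R -> (n < N)%N ->
  (sum_moment n s <= coefficient_moment n s * abs_moment P s +
    (cross_bound k s n)%:E * (abs_moment P (s - 1) * abs_moment P 1))%E.
Proof.
move=> s1 sk nN; pose c := k%:R * n.+1%:R `^ (s - 1).
have c0 : 0 <= c by rewrite mulr_ge0// powR_ge0.
pose X (w : Rn R n.+1 * Rn R n.+1) i j := term w i `^ (s - 1) * term w j.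
have X0 w i j : 0 <= X w i j by rewrite mulr_ge0 ?powR_ge0// term_ge0.
have mt (t : R) (i : 'I_n.+1) : measurable_fun setT
    (fun w : Rn R n.+1 * Rn R n.+1 => term w i `^ t).
  by apply: (measurableT_comp (measurable_powR t)); exact: measurable_term.
have mX i j : measurable_fun setT (fun w => X w i j).
  by apply: measurable_funM => //; exact: measurable_term.
have mXs : measurable_fun setT (fun w => \sum_i \sum_(j | j != i) X w i j).
  apply: measurable_sum => i; under eq_fun do rewrite big_mkcond.
  by apply: measurable_sum => j; case: (j != i) => //; exact: measurable_cst.
have Xs0 w : 0 <= \sum_i \sum_(j | j != i) X w i j.
  by apply: sumr_ge0 => i _; apply: sumr_ge0.
apply: (@le_trans _ _ (\int[prod_prob (A n.+1) (power_prob P n.+1)]_w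
   ((\sum_i term w i `^ s)%:E + c%:E * (\sum_i \sum_(j | j != i) X w i
     j)%:E))%E).
  apply: ge0_le_integral => //.
  - by move=> w _; rewrite lee_fin powR_ge0.
  - exact: measurable_sum_moment.
  - apply: emeasurable_funD.
      by apply/measurable_EFinP; apply: measurable_sum.
    apply: emeasurable_funM; first exact: measurable_cst.
    exact/measurable_EFinP.
  - move=> w _; rewrite -EFinM -EFinD lee_fin; apply: powR_sum_le => // i.
    exact: term_ge0.
rewrite ge0_integralD//; last 4 first.
- by move=> w _; rewrite lee_fin sumr_ge0// => i _; exact: powR_ge0.
- by apply/measurable_EFinP; apply: measurable_sum.
- by move=> w _; rewrite mule_ge0// lee_fin.
- by apply: emeasurable_funM; [exact: measurable_cst|exact/measurable_EFinP].
rewrite integral_sum_terms leeD2l// ge0_integralZl//; last 2 first.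
- exact/measurable_EFinP.
- by move=> w _; rewrite lee_fin.
rewrite /cross_bound -/c [X in (_ <= X * _)%E]EFinM -muleA.
apply: lee_wpmul2l => //.
have E : (\int[prod_prob (A n.+1) (power_prob P n.+1)]_w
    (\sum_i \sum_(j | j != i) X w i j)%:E =
    \sum_i \sum_(j | j != i) \int[prod_prob (A n.+1) (power_prob P n.+1)]_w
      (X w i j)%:E)%E.
  under eq_integral => w _.
    rewrite -sumEFin; under eq_bigr => i _ do rewrite -sumEFin big_mkcond.
    over.
  have mif i j : measurable_fun setT (fun w => if j != i then (X w i j)%:E
    else 0%E).
    case: (j != i); last exact: measurable_cst.
    exact/measurable_EFinP.
  have if0 w i j : (0 <= if j != i then (X w i j)%:E else 0%E)%E.
    by case: (j != i) => //; rewrite lee_fin.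
  rewrite ge0_integral_sum//; last 2 first.
  - by move=> i; apply: emeasurable_sum => j; exact: mif.
  - by move=> i w _; apply: sume_ge0 => j _; exact: if0.
  apply: eq_bigr => i _; rewrite ge0_integral_sum//.
  rewrite [RHS]big_mkcond; apply: eq_bigr => j _; case: (j != i) => //.
  by rewrite integral0.
rewrite E -sumEFin ge0_sume_distrl; last first.
  move=> i _; rewrite lee_fin; apply: sumr_ge0 => j _.
  by rewrite mulr_ge0// powR_ge0.
apply: lee_sum => i _; rewrite -sumEFin ge0_sume_distrl; last first.
  by move=> j _; rewrite lee_fin mulr_ge0// powR_ge0.
by apply: lee_sum => j ji; apply: cross; rewrite // eq_sym.
Qed.

End step_moments.

(** * Uniform moment bounds along the iteration, and their limit *)

Section iterate_moments.
Context (R : realType) (N : nat).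
Variables (alpha : nat -> {nonneg R}) (A : forall n, probability (Rn R n) R).
Hypothesis alpha_sum : \sum_(n < N) (alpha n.+1)%:num = 1.
Variable C : nat -> R.
Hypothesis A_box : forall n, (n < N)%N ->
  A n.+1 [set a | forall i, 0 < tnth a i <= C n] = 1%E.
Hypothesis A_sym : forall n, (n < N)%N -> symmetric_measure (A n.+1).
Hypotheses (N_gt0 : (0 < N)%N) (alphaN_gt0 : 0 < (alpha N)%:num).

Let m := mu N alpha A 1.
Local Notation lam := (lambda N alpha A).
Local Notation stepm := (step A alpha_sum m).

Lemma mu1E : m = lam 1 - 1.
Proof. by rewrite /m /mu divr1. Qed.

Lemma lambda_coefficient (s : R) : 0 <= s ->
  ((lam s)%:E = \sum_(n < N) ((alpha n.+1)%:num)%:E * coefficient_moment A n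
    s)%E.
Proof. by move=> s0; rewrite (lambdaE _ A_box). Qed.

Lemma sum_coefficient (s : R) (x : \bar R) : 0 <= s ->
  (\sum_(n < N) ((alpha n.+1)%:num)%:E * (coefficient_moment A n s * x) =
   (lam s)%:E * x)%E.
Proof.
move=> s0; rewrite lambda_coefficient// ge0_sume_distrl; last first.
  by move=> n _; rewrite mule_ge0// coefficient_moment_ge0.
by apply: eq_bigr => n _; rewrite muleA.
Qed.

(** The diagonal contributes $\lambda(1)$ and the factor $U^m$ contributes $1/(1+m)$; they cancel
    because $m=\mu(1)=\lambda(1)-1$. *)
Lemma mean_step (P : probability (measurableTypeR R) R) :
  abs_moment (stepm P) 1 = abs_moment P 1.
Proof.
have l1 : 0 < lam 1 by exact: (lambda_gt0 A_box).
rewrite moment_step; last by rewrite mulr1 mu1E; lra.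
under eq_bigr => n _ do rewrite sum_moment1.
rewrite sum_coefficient// mulr1 mu1E addrC subrK muleA -EFinM mulVf ?mul1e//.
by rewrite gt_eqF.
Qed.

Lemma abs_moment_dirac1 (s : R) :
  abs_moment (dirac (1 : measurableTypeR R)) s = 1%E.
Proof.
rewrite /abs_moment integral_dirac//.
  by rewrite diracT mul1e normr1 powR1.
by apply/measurable_EFinP; exact: measurable_norm_powR.
Qed.

Lemma mean_iterate n : abs_moment (step_iterate A alpha_sum n) 1 = 1%E.
Proof.
elim: n => [|n IHn]; first exact: abs_moment_dirac1.
by rewrite -[RHS]IHn; exact: mean_step.
Qed.

Lemma moment_step_le (P : probability (measurableTypeR R) R) (s B B' : R) (k :
  nat) :
  1 <= s -> s <= k%:R -> - 1 < m * s -> abs_moment P 1 = 1%E ->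
  (abs_moment P s <= B%:E)%E -> (abs_moment P (s - 1) <= B'%:E)%E ->
  (abs_moment (stepm P) s <= ((1 + m * s)^-1 * (lam s * B +
    (\sum_(n < N) (alpha n.+1)%:num * cross_bound C k s n) * B'))%:E)%E.
Proof.
move=> s1 sk ms P1 PB PB'; have s0 : 0 <= s by lra.
rewrite moment_step// EFinM; apply: lee_wpmul2l.
  by rewrite lee_fin invr_ge0; lra.
apply: (@le_trans _ _ (\sum_(n < N) ((alpha n.+1)%:num)%:E *
   (coefficient_moment A n s * B%:E + (cross_bound C k s n)%:E * B'%:E))%E).
  apply: lee_sum => n _; apply: lee_wpmul2l => //.
  apply: (le_trans (sum_moment_le A_box P s1 sk (ltn_ord n))).
  rewrite P1 mule1; apply: leeD; first
    exact/lee_wpmul2l/PB/coefficient_moment_ge0.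
  by apply: lee_wpmul2l => //; rewrite lee_fin cross_bound_ge0.
have B0 : (0 <= B%:E)%E by exact: le_trans (abs_moment_ge0 P s) PB.
have B'0 : (0 <= B'%:E)%E by exact: le_trans (abs_moment_ge0 P (s - 1)) PB'.
under eq_bigr => n _.
  rewrite ge0_muleDr; last 2 first.
  - by rewrite mule_ge0// coefficient_moment_ge0.
  - by rewrite mule_ge0// lee_fin cross_bound_ge0.
  over.
rewrite big_split/= sum_coefficient// EFinD EFinM leeD2l//.
rewrite EFinM -sumEFin ge0_sume_distrl; last first.
  by move=> n _; rewrite lee_fin mulr_ge0// cross_bound_ge0.
by apply: lee_sum => n _; rewrite EFinM muleA.
Qed.

Variable S : R.
Hypothesis subcritical : forall s, 1 < s -> s < S -> lam s < 1 + m * s.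

(** Induction on an integer above [s], because the cross terms call for the order $s-1$. For $s\le2$
    that order is at most 1 and is controlled by the mean, which all iterates share. *)
Lemma iterate_moment_bounded (k : nat) (s : R) : 1 < s -> s < S -> s <=
  k.+1%:R ->
  exists2 B : R, 0 <= B &
    forall n, (abs_moment (step_iterate A alpha_sum n) s <= B%:E)%E.
Proof.
elim: k s => [|k IHk] s s1 sS sk; first by move: s1; rewrite ltNge sk.
have [B' B'0 PB'] : exists2 B' : R, 0 <= B' &
    forall n, (abs_moment (step_iterate A alpha_sum n) (s - 1) <= B'%:E)%E.
  have [s2|s2] := leP s 2.
    exists 2 => // n.
    have s10 : 0 <= s - 1 by lra.
    have s11 : s - 1 <= 1 by lra.
    apply: le_trans (integral_powR_le1D (step_iterate A alpha_sum n)
      (@normr_measurable R setT) (fun v => normr_ge0 v) s10 s11) _.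
    by rewrite -/(abs_moment _ 1) mean_iterate -EFinD lee_fin; lra.
  apply: IHk; [by lra|by lra|].
  by rewrite lerBlDr natr1.
have lams := subcritical s1 sS.
have lam0 : 0 < lam s by apply: (lambda_gt0 A_box) => //; lra.
have ms : - 1 < m * s by lra.
pose D := \sum_(n < N) (alpha n.+1)%:num * cross_bound C k.+2 s n.
have D0 : 0 <= D.
  by apply: sumr_ge0 => n _; rewrite mulr_ge0// cross_bound_ge0.
pose d := 1 + m * s - lam s.
have d0 : 0 < d by rewrite /d; lra.
(* With $d=1+ms-\lambda(s)>0$ this satisfies $\lambda(s)B+DB'\le(1+ms)B$, so the bound reproduces
   itself; the summand 1 covers the initial Dirac mass. *)
pose B := 1 + D * B' / d.
have DB0 : 0 <= D * B' / d by rewrite divr_ge0 ?mulr_ge0// ltW.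
have B0 : 0 <= B by rewrite /B; lra.
exists B => // n; elim: n => [|n IHn].
  by rewrite /step_iterate/= abs_moment_dirac1 lee_fin /B; lra.
have s1' := ltW s1.
apply: (le_trans (moment_step_le s1' sk ms (mean_iterate n) IHn (PB' n))).
rewrite -/D lee_fin.
have e0 : 0 < 1 + m * s by lra.
rewrite ler_pdivrMl//.
have -> : 1 + m * s = lam s + d by rewrite /d; ring.
have DE : D * B' / d * d = D * B' by rewrite divfK// gt_eqF.
rewrite mulrDl lerD2l /B mulrDr mulr1 [d * _]mulrC DE; lra.
Qed.

(** A uniform moment bound at an order [t] strictly between $\max(1,s)$ and [S] gives [ldiff] at
    most $By^t$ for every iterate, hence for [Q] in the limit; the gap $t-s$ is then spent in
    [moment_lty_of_ldiff]. *)
Lemma limit_moment_lty (Q : probability (measurableTypeR R) R) :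
  (forall x, 0 <= x ->
    laplace_rv (step_iterate A alpha_sum n) Num.norm x @[n --> \oo] -->
    laplace_rv Q Num.norm x) ->
  1 < S -> forall s, 0 < s -> s < S -> (abs_moment Q s < +oo)%E.
Proof.
move=> PQ S1 s s0 sS.
pose t := (Num.max 1 s + S) / 2.
have [mx1 mxs] : 1 <= Num.max 1 s /\ s <= Num.max 1 s.
  by rewrite !le_max !lexx orbT.
have mxS : Num.max 1 s < S by rewrite gt_max S1.
have t1 : 1 < t by rewrite /t; lra.
have tS : t < S by rewrite /t; lra.
have st : s < t by rewrite /t; lra.
have t0 : 0 < t by lra.
pose k := Num.Def.trunc t.
have tk : t <= k.+1%:R by exact/ltW/truncnS_gt.
have [B B0 PB] := iterate_moment_bounded t1 tS tk.
have mn : measurable_fun setT (@Num.norm R R) by exact: normr_measurable.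
apply: (@moment_lty_of_ldiff R _ _ Q Num.norm mn (fun v => normr_ge0 v) k.+1 B
  s t s0 st B0).
move=> y y0.
have c := @cvg_ldiff R _ _ (measurableTypeR R) (measurableTypeR R)
  (step_iterate A alpha_sum) Q Num.norm Num.norm mn (fun v => normr_ge0 v)
  mn (fun v => normr_ge0 v) PQ k.+1 y 0 (ltW y0) (lexx 0).
rewrite -(cvg_lim (@Rhausdorff R) c); apply: limr_le; first exact: cvgP c.
apply: nearW => n; rewrite -lee_fin.
apply: (le_trans (@ldiff_le_moment R _ _ (step_iterate A alpha_sum n) Num.norm
  mn
  (fun v => normr_ge0 v) k.+1 y t t0 tk (ltW y0))).
rewrite mulrC EFinM; apply: lee_wpmul2l; last exact: PB.
by rewrite lee_fin powR_ge0.
Qed.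

End iterate_moments.

(** * The moment at the critical exponent *)

Section critical_moment.
Context (R : realType) (N : nat).
Variables (alpha : nat -> {nonneg R}) (A : forall n, probability (Rn R n) R).
Hypothesis alpha_sum : \sum_(n < N) (alpha n.+1)%:num = 1.
Variable C : nat -> R.
Hypothesis A_box : forall n, (n < N)%N ->
  A n.+1 [set a | forall i, 0 < tnth a i <= C n] = 1%E.
Hypothesis A_sym : forall n, (n < N)%N -> symmetric_measure (A n.+1).
Variables (Q : probability (measurableTypeR R) R) (s : R).
Hypotheses (s1 : 1 < s) (Q1 : abs_moment Q 1 = 1%E).

Let delta n (w : Rn R n.+1 * Rn R n.+1) : R :=
  (\sum_k term w k) `^ s - \sum_k term w k `^ s.

Let delta_ge0 n (w : Rn R n.+1 * Rn R n.+1) : 0 <= delta w.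
Proof.
rewrite subr_ge0; apply: sum_powR_le; last exact: ltW.
by move=> k; exact: term_ge0.
Qed.

Let measurable_terms n :
  measurable_fun setT (fun w : Rn R n.+1 * Rn R n.+1 => \sum_k term w k `^ s).
Proof.
apply: measurable_sum => k; apply: (measurableT_comp (measurable_powR s)).
exact: measurable_term.
Qed.

Let measurable_delta n : measurable_fun setT (@delta n).
Proof.
apply: measurable_funB; last exact: measurable_terms.
by apply/measurable_EFinP; exact: (@measurable_sum_moment R n.+1 s).
Qed.

(** The counterpart of $I_{n+1}(s)$, with absolute values in place of the restrictions to
    orthants. *)
Let excess n : \bar R :=
  (\int[prod_prob (A n.+1) (power_prob Q n.+1)]_w (delta w)%:E)%E.

Let sum_moment_excess n :
  sum_moment A Q n s = (coefficient_moment A n s * abs_moment Q s + excess n)%E.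
Proof.
rewrite -integral_sum_terms -ge0_integralD//.
- by apply: eq_integral => w _; rewrite -EFinD /delta addrC subrK.
- by move=> w _; rewrite lee_fin sumr_ge0// => k _; exact: powR_ge0.
- by apply/measurable_EFinP; exact: measurable_terms.
- by move=> w _; rewrite lee_fin.
- by apply/measurable_EFinP; exact: measurable_delta.
Qed.

(* The excess vanishes only if some coefficients [a_k > 0] leave almost no room
   for two of the variables to be positive, against [E X_i X_j = 1]. *)
Let excess_neq0 n : (n < N)%N -> (0 < n)%N -> excess n <> 0%E.
Proof.
move=> nN n0; rewrite /excess ge0_integral_prod_prob; last 2 first.
- by apply/measurable_EFinP; exact: measurable_delta.
- by move=> w; rewrite lee_fin.
pose h (a : Rn R n.+1) : \bar R := (\int[power_prob Q n.+1]_x (delta (a,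
  x))%:E)%E.
have h0 a : (0 <= h a)%E by apply: integral_ge0 => x _; rewrite lee_fin.
have mh : measurable_fun setT h.
  apply: (measurable_fun_fubini_tonelli_F (m2 := power_prob Q n.+1)
    (fun w => (@delta n w)%:E)).
    by apply/measurable_EFinP; exact: measurable_delta.
  by move=> w; rewrite lee_fin.
move=> E; have : (\int[A n.+1]_a `|h a|)%E = 0%E.
  by rewrite -[RHS]E; apply: eq_integral => a _; rewrite gee0_abs.
move=> /(ae_eq_integral_abs (A n.+1) measurableT mh) [Z [mZ Z0 subZ]].
(* The box has full measure, so it is not contained in the null set [Z]: some positive coefficients
   have a vanishing inner integral. *)
have [a [Ca ha]] : exists a : Rn R n.+1,
    (forall i, 0 < tnth a i <= C n) /\ h a = 0%E.
  apply: contrapT => nex.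
  have : (A n.+1 [set a | forall i, (0 < tnth a i <= C n)%R] <= A n.+1 Z)%E.
    apply: le_measure; rewrite ?inE//; first exact: measurable_box.
    move=> a Ca; apply: subZ => /= ha; apply: nex; exists a; split => //.
    exact: ha.
  by rewrite (A_box nN) Z0 lee_fin ler10.
have md : measurable_fun setT (fun x : Rn R n.+1 => (delta (a, x))%:E).
  apply/measurable_EFinP.
  exact: (measurableT_comp (@measurable_delta n) (measurable_pair1 a)).
have : (\int[power_prob Q n.+1]_x `|(delta (a, x))%:E|)%E = 0%E.
  by rewrite -[RHS]ha; apply: eq_integral => x _; rewrite gee0_abs// lee_fin.
move=> /(ae_eq_integral_abs (power_prob Q n.+1) measurableT md) [Y [mY Y0
  subY]].
pose i : 'I_n.+1 := ord0; pose j : 'I_n.+1 := ord_max.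
have ij : i != j by rewrite -val_eqE/= eq_sym -lt0n.
have mij : measurable_fun setT (fun x : Rn R n.+1 => (`|tnth x i| * `|tnth x
  j|)%:E).
  by apply/measurable_EFinP; apply: measurable_funM; exact:
    measurable_abs_coordinate.
have one : (\int[Q]_v `|v|%:E = 1)%E.
  by rewrite -Q1; apply: eq_integral => v _; rewrite powRr1.
have := @integral_power_prob2 _ _ _ Q n.+1 i j (fun v => `|v|) (fun v => `|v|)
  ij
  (@normr_measurable R setT) (fun v => normr_ge0 v)
  (@normr_measurable R setT) (fun v => normr_ge0 v).
rewrite one mule1 (@ge0_ae_eq_integral _ _ _ _ _ _ (cst 0%E))//.
- by rewrite integral_cst// mul0e => -[/esym/eqP]; rewrite oner_eq0.
exists Y; split => // x /= nx; apply: subY => /= dx; apply: nx => _.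
have [d0] := dx I; congr EFin; apply/eqP.
apply: contra_eqT d0; rewrite mulf_eq0 !normr_eq0 negb_or => /andP[xi xj].
rewrite gt_eqF// subr_gt0; apply: (@sum_powR_lt _ _ _ _ _ i j) => //.
- by move=> k; exact: term_ge0.
- have /andP[a0 _] := Ca i.
  by rewrite /term mulr_gt0// normr_gt0// gt_eqF.
- have /andP[a0 _] := Ca j.
  by rewrite /term mulr_gt0// normr_gt0// gt_eqF.
Qed.

Let m := mu N alpha A 1.

(** A finite moment $M$ could be cancelled from
    $M=(\lambda(s)M+\sum_n\alpha_n\,\mathrm{excess}_n)/(1+ms)$, where $\lambda(s)=1+ms$; the sum of
    the excesses would then vanish. *)
Lemma critical_moment_pinfty : (2 <= N)%N -> 0 < (alpha N)%:num ->
  (forall x, 0 <= x -> laplace_rv (step A alpha_sum m Q) Num.norm x =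
    laplace_rv Q Num.norm x) ->
  lambda N alpha A s = 1 + m * s -> abs_moment Q s = +oo%E.
Proof.
move=> N2 aN QE ls; apply/eqP; rewrite -leye_eq leNgt; apply/negP => Qs.
have s0 : 0 < s := lt_trans ltr01 s1.
have N0 : (0 < N)%N by exact: leq_trans N2.
have N1 : (N.-1 < N)%N by rewrite prednK.
have l0 : 0 < lambda N alpha A s by apply: (lambda_gt0 A_box) => //; exact: ltW.
have mn : measurable_fun setT (@Num.norm R R) by exact: normr_measurable.
have SQ : abs_moment (step A alpha_sum m Q) s = abs_moment Q s.
  exact: (@eq_moment_laplace_rv R _ _ _ _ (step A alpha_sum m Q) Q Num.norm
    Num.norm
    s mn (fun v => normr_ge0 v) mn (fun v => normr_ge0 v) s0 QE).
have Qfin : abs_moment Q s \is a fin_num.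
  by rewrite ge0_fin_numE ?abs_moment_ge0.
have e0 n : (0 <= excess n)%E by apply: integral_ge0 => w _; rewrite lee_fin.
have ae0 n : (0 <= ((alpha n.+1)%:num)%:E * excess n)%E by rewrite mule_ge0.
have ms : - 1 < m * s by move: l0; rewrite ls; lra.
move: SQ; rewrite (moment_step _ _ _ ms).
rewrite -ls.
under eq_bigr => n _.
  rewrite sum_moment_excess ge0_muleDr//; last first.
    by rewrite mule_ge0// ?coefficient_moment_ge0// abs_moment_ge0.
  over.
rewrite big_split/= (sum_coefficient alpha A_box A_sym) ?(ltW s0)//.
rewrite ge0_muleDr; last 2 first.
- by rewrite mule_ge0// ?abs_moment_ge0// lee_fin ltW.
- exact: sume_ge0.
rewrite muleA -EFinM mulVf ?gt_eqF// mul1e => E.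
have : (((lambda N alpha A s)^-1)%:E *
    \sum_(n < N) ((alpha n.+1)%:num)%:E * excess n)%E = 0%E.
  by rewrite -[LHS](addeK _ Qfin) [X in (X - _)%E]addeC E subee.
move=> /eqP; rewrite mule_eq0 eqe invr_eq0 gt_eqF//=.
(* All summands vanish; the last one carries [alpha N], which is positive, and involves at least two
   variables because $N\ge2$. *)
rewrite seq_psume_eq0// => /allP/(_ (Ordinal N1)).
rewrite mem_index_enum => /(_ isT)/=.
rewrite mule_eq0 => /orP[|/eqP]; first by rewrite eqe prednK// gt_eqF.
by apply: excess_neq0 => //; rewrite -ltnS prednK.
Qed.

End critical_moment.

(** * Passage from integrals over the half-line to absolute values *)

Section halfline.
Context (R : realType) (P : probability (measurableTypeR R) R).
Hypothesis P_halfline : on_halfline P.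

Lemma laplace_abs (x : R) : laplace P x = laplace_rv P Num.norm x.
Proof.
have mD : measurable (`[0%R, +oo[%classic : set (measurableTypeR R)).
  exact: measurable_itv.
have mx (X : measurableTypeR R -> R) : measurable_fun setT X ->
    measurable_fun setT (fun v => expR (- (x * X v))).
  by move=> mX; exact: measurable_expRN.
apply: (prob_eq_Rintegral mD P_halfline _ (mx _ (@normr_measurable R setT))).
  by apply: measurable_funTS; apply: (mx id); exact: measurable_id.
by move=> v; rewrite inE/= in_itv/= andbT => v0; rewrite ger0_norm.
Qed.

Lemma moment_abs (s : R) : moment P s = abs_moment P s.
Proof.
have mD : measurable (`[0%R, +oo[%classic : set (measurableTypeR R)).
  exact: measurable_itv.
apply: (prob_eq_integral mD P_halfline).
- by apply: measurable_funTS; apply/measurable_EFinP; exact: measurable_powR.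
- by apply/measurable_EFinP; exact: measurable_norm_powR.
- by move=> v; rewrite inE/= in_itv/= andbT => v0; rewrite ger0_norm.
Qed.

End halfline.

(** * Where [mu] lies below its value at 1 *)

Section spectral_function.
Context (R : realType) (N : nat).
Variables (alpha : nat -> {nonneg R}) (A : forall n, probability (Rn R n) R).
Variable C : nat -> R.
Hypothesis A_box : forall n, (n < N)%N ->
  A n.+1 [set a | forall i, 0 < tnth a i <= C n] = 1%E.

Let m := mu N alpha A 1.
(** For $s>0$ the sign of [g] is that of $\mu(s)-\mu(1)$; the function [g] inherits convexity from
    [lambda] and vanishes at 1. *)
Let g (s : R) := lambda N alpha A s - (1 + m * s).

Lemma mu_lt_mu1 (s : R) : 0 < s ->
  (mu N alpha A s < m) = (lambda N alpha A s < 1 + m * s).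
Proof. by move=> s0; rewrite /mu ltr_pdivrMr// ltrBlDl. Qed.

Lemma mu_eq_mu1 (s : R) : 0 < s ->
  mu N alpha A s = m <-> lambda N alpha A s = 1 + m * s.
Proof.
move=> s0; rewrite {1}/mu; split=> [E|->].
  by rewrite -E divfK ?gt_eqF// addrC subrK.
by rewrite addrC addKr mulfK// gt_eqF.
Qed.

Let g_convex (x y t : R) : 0 < x -> 0 < y -> 0 <= t -> t <= 1 ->
  g ((1 - t) * x + t * y) <= (1 - t) * g x + t * g y.
Proof.
move=> x0 y0 t0 t1; have := lambda_convex alpha A_box x0 y0 t0 t1.
by rewrite /g; lra.
Qed.

Let g1 : g 1 = 0.
Proof. by rewrite /g /m /mu divr1; ring. Qed.

Let g_chord (s r : R) : 1 < s -> s < r ->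
  exists t, [/\ 0 < t, t < 1 & g s <= t * g r].
Proof.
move=> s1 sr; have r1 : 0 < r - 1 by lra.
pose t := (s - 1) / (r - 1).
have t0 : 0 < t by rewrite divr_gt0//; lra.
have t1 : t < 1 by rewrite ltr_pdivrMr// mul1r; lra.
exists t; split => //.
have r0 : 0 < r by lra.
have := g_convex ltr01 r0 (ltW t0) (ltW t1).
rewrite g1 mulr0 add0r.
have -> // : (1 - t) * 1 + t * r = s.
rewrite [LHS](_ : _ = 1 + t * (r - 1)); last by ring.
by rewrite /t divfK ?gt_eqF// addrC subrK.
Qed.

(** Between 1 and [r] the chord from the zero at 1 keeps [g] negative. Beyond [r], a positive value
    would produce by convexity a zero to the right of 1, a second solution. *)
Lemma subcritical_unbounded (r : R) : 1 < r -> mu N alpha A r < m ->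
  (forall s, 0 < s -> mu N alpha A s = m -> s = 1) ->
  forall s, 1 < s -> lambda N alpha A s < 1 + m * s.
Proof.
move=> r1 mr uniq s s1; have r0 : 0 < r by lra.
have s0 : 0 < s by lra.
have gr : g r < 0 by rewrite subr_lt0 -mu_lt_mu1.
have gn0 c : 1 < c -> g c <> 0.
  move=> c1 /eqP; rewrite subr_eq0 => /eqP gc; have c0 : 0 < c by lra.
  have := uniq c c0 ((mu_eq_mu1 c0).2 gc); lra.
rewrite -subr_lt0 -/(g s) ltNge; apply/negP => gs.
have {}gs : 0 < g s by rewrite lt_neqAle gs andbT eq_sym; exact/eqP/gn0.
have [sr|rs|sr] := ltgtP s r.
- have [t [t0 t1 gt]] := g_chord s1 sr.
  have : t * g r < 0 by rewrite pmulr_rlt0.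
  lra.
- have [c rc gc] := convex_zero_after g_convex r0 rs gr gs.
  by apply: (gn0 c) => //; lra.
- by move: gs gr; rewrite sr; lra.
Qed.

(** The chord between the two zeros 1 and [s_] gives $g\le0$ in between, and equality would be a
    third solution. *)
Lemma subcritical_before (s_ : R) : 1 < s_ ->
  (forall s, 0 < s -> mu N alpha A s = m <-> s = 1 \/ s = s_) ->
  forall s, 1 < s -> s < s_ -> lambda N alpha A s < 1 + m * s.
Proof.
move=> s_1 sols s s1 ss; have s0 : 0 < s by lra.
have s_0 : 0 < s_ by lra.
have gs_ : g s_ = 0.
  by apply/eqP; rewrite subr_eq0; apply/eqP/(mu_eq_mu1 s_0)/(sols _ s_0); right.
have [t [t0 t1]] := g_chord s1 ss; rewrite gs_ mulr0 => gs.
rewrite -subr_lt0 -/(g s) lt_neqAle gs andbT; apply/eqP => /eqP.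
rewrite subr_eq0 => /eqP/(mu_eq_mu1 s0)/(sols _ s0)[]; lra.
Qed.

End spectral_function.

Theorem proposition10p3 (R : realType) (N d : nat)
  (alpha : nat -> {nonneg R}) (A : forall n, probability (Rn R n) R)
  (p0 : \bar R) (p : R) (psi : R -> R)
  (Rp Phi : probability (measurableTypeR R) R) (F : probability (Rn R d) R)
  (N_ge2 : (2 <= N)%N)
  (alpha_sum : \sum_(1 <= n < N.+1) (alpha n)%:num = 1)
  (alphaN_gt0 : 0 < (alpha N)%:num)
  (A_support : forall n, (1 <= n <= N)%N -> bounded_positive_support (A n))
  (A_sym : forall n, (1 <= n <= N)%N -> symmetric_measure (A n))
  (d_ge1 : (1 <= d)%N)
  (p0_min : is_minimum_point (mu N alpha A) p0)
  (p_gt0 : 0 < p) (p_le1 : p <= 1) (p_lt_p0 : (p%:E < p0)%E)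
  (psi_profile : self_similar_profile N alpha A p psi)
  (Rp_psi : represents p psi Rp)
  (F_isotropic : isotropic F)
  (F_fourier : has_fourier_transform F (fun k => psi (enorm k ^+ 2)))
  (Phi_halfline : on_halfline Phi)
  (Phi_laplace : forall x, 0 <= x -> laplace Phi x = psi x) :
  (p < 1 ->
     forall s, 0 < s ->
       ((moment2 F s < +oo)%E <-> s < p) /\ ((moment Phi s < +oo)%E <-> s < p))
  /\
  (p = 1 ->
     forall m : R -> \bar R, m = moment2 F \/ m = moment Phi ->
       ((forall s, 0 < s -> mu N alpha A s = mu N alpha A 1 -> s = 1) ->
          forall s, 0 < s -> (m s < +oo)%E)
       /\
       (forall s_ : R, 1 < s_ ->
          (forall s, 0 < s ->
             (mu N alpha A s = mu N alpha A 1 <-> s = 1 \/ s = s_)) ->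
          [/\ forall s, 0 < s -> s < s_ -> (m s < +oo)%E,
              forall s, s_ < s -> m s = +oo%E
            & (m s_ < +oo)%E ->
              forall n, (2 <= n <= N)%N -> I_ A Rp n s_ = 0%E])).
Proof.
have asum : \sum_(n < N) (alpha n.+1)%:num = 1.
  by rewrite -[RHS]alpha_sum big_add1/= big_mkord.
have N0 : (0 < N)%N by exact: leq_trans N_ge2.
have [C A_box] : exists C : nat -> R, forall n, (n < N)%N ->
    A n.+1 [set a | forall i, 0 < tnth a i <= C n] = 1%E.
  have /choice[C hC] : forall n, exists c : R, (n < N)%N ->
      A n.+1 [set a | forall i, 0 < tnth a i <= c] = 1%E.
    move=> n; have [nN|_] := boolP (n < N)%N; last by exists 0.
    by have [c hc] := @A_support n.+1 nN; exists c.
  by exists C.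
have A_sym' n : (n < N)%N -> symmetric_measure (A n.+1).
  by move=> nN; exact: A_sym.
have [Rp_half Rp_mean psiR] := Rp_psi.
have mn : measurable_fun setT (@Num.norm R R) by exact: normr_measurable.
have n0 (v : R) : 0 <= `|v| by exact: normr_ge0.
have psi_Rp x : 0 <= x -> psi x = laplace_rv Rp Num.norm (x `^ p).
  by move=> x0; rewrite psiR// laplace_abs.
have psi_Phi x : 0 <= x -> psi x = laplace_rv Phi Num.norm x.
  by move=> x0; rewrite -Phi_laplace// laplace_abs.
have Rp1 : abs_moment Rp 1 = 1%E.
  rewrite -moment_abs// -[RHS]Rp_mean; apply: eq_integral => t.
  by rewrite inE/= in_itv/= andbT => t0; rewrite powRr1.
have Rp1' : (\int[Rp]_v `|v|%:E = 1)%E.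
  by rewrite -Rp1; apply: eq_integral => v _; rewrite powRr1.
have momF s : 0 < s -> (moment2 F s < +oo)%E <-> (abs_moment Phi s < +oo)%E.
  by move=> s0; exact: (moment2_lty F_fourier psi_Phi).
split=> [p1 s s0|pE mom momE].
  have XY x : 0 <= x ->
      laplace_rv Phi Num.norm x = laplace_rv Rp Num.norm (x `^ p).
    by move=> x0; rewrite -psi_Phi// psi_Rp.
  have E : (abs_moment Phi s < +oo)%E <-> s < p.
    split=> [|sp]; last first.
      exact: (@stable_law_moment_lty R _ _ _ _ Phi Rp Num.norm Num.norm mn n0
        mn n0
        Rp1' p p_gt0 XY s s0 sp).
    apply: contraTT; rewrite -!leNgt => ps.
    have -> : abs_moment Phi s = +oo%E.
      exact: (@stable_law_moment_pinfty R _ _ _ _ Phi Rp Num.norm Num.norm mn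
        n0 mn n0
        Rp1' p p_gt0 p1 XY s ps).
    exact: lexx.
  by rewrite moment_abs//; split; rewrite ?momF//.
subst p.
have psi_Rp1 x : 0 <= x -> psi x = laplace_rv Rp Num.norm x.
  by move=> x0; rewrite psi_Rp// powRr1.
(* For $p=1$ the transforms of [Phi] and [Rp] coincide, so either choice of [mom] is governed by the
   moments of [Rp]. *)
have momR s : 0 < s -> (mom s < +oo)%E <-> (abs_moment Rp s < +oo)%E.
  move=> s0; have -> : abs_moment Rp s = abs_moment Phi s.
    apply: (@eq_moment_laplace_rv R _ _ _ _ Rp Phi Num.norm Num.norm) => // x
      x0.
    by rewrite -psi_Phi// psi_Rp1.
  by case: momE => ->; [exact: momF|rewrite moment_abs].
have [cvgP fixP] := profile_fixed_point asum (box_orthant A_box) psi_profile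
  psi_Rp1.
(* Since $p_0>1$, the minimum point itself serves as [r] if it is finite, and 2 does if [mu]
   decreases throughout. *)
have [r r1 mur] : exists2 r, 1 < r & mu N alpha A r < mu N alpha A 1.
  case: p0 p0_min p_lt_p0 => [r|/=|//] /=.
    move=> [r0 rmin]; rewrite lte_fin => r1; exists r => //.
    by apply: rmin => //; rewrite lt_eqF.
  by move=> dec _; exists 2; [lra|apply: dec; lra].
split=> [uniq s s0|s_ s_1 sols].
  apply/momR => //.
  (* [limit_moment_lty] takes a real upper end of the subcritical range; with a unique solution any
     will do, and $s+2$ exceeds both 1 and [s]. *)
  have sub t : 1 < t -> t < s + 2 ->
      lambda N alpha A t < 1 + mu N alpha A 1 * t.
    by move=> t1 _; exact: (subcritical_unbounded A_box r1 mur uniq).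
  apply: (limit_moment_lty A_box A_sym' N0 alphaN_gt0 sub cvgP) => //; lra.
have s_0 : 0 < s_ by lra.
have sub := subcritical_before A_box s_1 sols.
have crit : lambda N alpha A s_ = 1 + mu N alpha A 1 * s_.
  by apply/(mu_eq_mu1 N alpha A s_0)/(sols _ s_0); right.
have infty : abs_moment Rp s_ = +oo%E.
  exact: (critical_moment_pinfty A_box A_sym' s_1 Rp1 N_ge2 alphaN_gt0 fixP
    crit).
have infty' s : s_ <= s -> ~ (mom s < +oo)%E.
  move=> ss; have s0 : 0 < s by lra.
  move=> /(momR _ s0) h.
  have : (1 + abs_moment Rp s < +oo)%E by rewrite lte_add_pinfty ?ltry.
  apply/negP; rewrite -leNgt -infty.
  exact: (integral_powR_le1D Rp mn n0 (ltW s_0) ss).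
split=> [s s0 ss|s ss|h].
- by apply/momR => //; exact: (limit_moment_lty A_box A_sym' N0 alphaN_gt0 sub
  cvgP).
- by apply/eqP; rewrite -leye_eq leNgt; apply/negP/infty'/ltW.
- by have := infty' s_ (lexx _) h.
Qed.
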